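(* For every $k\geq1$ there is $K\geq1$ such that the following holds. Let $\mathcal{H}$ be a hereditary property of $3$-graphs with $k\otimes U(k)\notin\mathrm{Trip}(\mathcal{H})$. Then, asymptotically, $$M^{weak}_{\mathcal{H}}(\epsilon_1^{1/K})\leq T_{\mathcal{H}}(\epsilon_1,\epsilon_2)\leq M^{hom}_{\mathcal{H}}(\epsilon_1^{K}).$$
   Context: A $3$-graph is $H=(V,E)$ with $E$ a set of $3$-element subsets of $V$; write $xyz=\{x,y,z\}$, $\overline{E}=\{(x,y,z)\in V^3:xyz\in E\}$, and for $X,Y,Z\subseteq V$, $d_H(X,Y,Z)=|\overline{E}\cap(X\times Y\times Z)|/(|X||Y||Z|)$. A hereditary property of $3$-graphs is a class of finite $3$-graphs closed under isomorphism and induced sub-$3$-graphs. For a graph $G=(V,E)$, $n\otimes G$ is the $3$-graph on $V\cup C$ ($C$ a new set of $n$ vertices) with edges $\{xyz:xy\in E,z\in C\}$. $U(k)$ is the graph on $\{a_i:i\in[k]\}\cup\{b_S:S\subseteq[k]\}$ with edges $\{a_ib_S:i\in S\}$. For a $3$-graph $H=(V,E)$, $\mathrm{Trip}(H)$ has vertices $\{a_v,b_v,c_v:v\in V\}$ (all distinct) and edges $\{a_vb_{v'}c_{v''}:vv'v''\in E\}$; $\mathrm{Trip}(\mathcal{H})$ is the closure under isomorphism and induced sub-$3$-graphs of $\{\mathrm{Trip}(H):H\in\mathcal{H}\}$. Homogeneous partitions: $(X,Y,Z)$ is $\epsilon$-homogeneous for $H$ if $d_H(X,Y,Z)\in[0,\epsilon)\cup(1-\epsilon,1]$;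 a partition $\mathcal{P}$ of $V$ is $\epsilon$-homogeneous for $H$ if for at least $(1-\epsilon)|V|^3$ triples $(x,y,z)\in V^3$ the triple $(X,Y,Z)\in\mathcal{P}^3$ with $(x,y,z)\in X\times Y\times Z$ is $\epsilon$-homogeneous. When $k\otimes U(k)\notin\mathrm{Trip}(\mathcal{H})$ for some $k$, it is known that for every $\epsilon\in(0,1)$ there is a bound $M$ such that all sufficiently large $H\in\mathcal{H}$ have $\epsilon$-homogeneous partitions with at most $M$ parts; $M^{hom}_{\mathcal{H}}(\epsilon)$ is the least such $M$. Weak regularity: $(X,Y,Z)$ is weakly $\epsilon$-regular for $H$ if for all $X'\subseteq X$, $Y'\subseteq Y$, $Z'\subseteq Z$ with $|X'|\geq\epsilon|X|$, $|Y'|\geq\epsilon|Y|$, $|Z'|\geq\epsilon|Z|$, $|d_H(X',Y',Z')-d_H(X,Y,Z)|\leq\epsilon$; a partition $\mathcal{P}$ of $V$ is weakly $\epsilon$-regular if for at least $(1-\epsilon)|V|^3$ triples $(x,y,z)\in V^3$ the triple of parts containing it is weakly $\epsilon$-regular. $M^{weak}_{\mathcal{H}}(\epsilon)$ is the least $M$ such that all sufficiently large $H\in\mathcal{H}$ have weakly $\epsilon$-regular partitions with at most $M$ parts. Decompositions: a bigraph is $B=(U,W;E)$, $E\subseteq U\times W$, density $d_B=|E|/(|U||W|)$; $B$ has $\mathrm{dev}_2(\epsilon,d)$ if $|d_B-d|\leq\epsilon$ and $\sum_{u_0,u_1\in U}\sum_{w_0,w_1\in W}\prod_{i,j\in\{0,1\}}g(u_i,w_j)\leq\epsilon|U|^2|W|^2$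 with $g=1-d_B$ on $E$, $-d_B$ off $E$; $\mathrm{dev}_2(\epsilon)$ means $\mathrm{dev}_2(\epsilon,d_B)$. A triad is $G=(X,Y,Z;E_{XY},E_{XZ},E_{YZ})$ ($E_{XY}\subseteq X\times Y$ etc.), $K_3(G)=\{(x,y,z):(x,y)\in E_{XY},(x,z)\in E_{XZ},(y,z)\in E_{YZ}\}$. With $d=|\overline{E}\cap K_3(G)|/|K_3(G)|$, $G$ has $\mathrm{dev}_{2,3}(\epsilon_1,\epsilon_2)$ w.r.t. $H$ if for some $d_{XY},d_{XZ},d_{YZ}>0$ the component bigraphs have $\mathrm{dev}_2(\epsilon_2,d_{XY}),\mathrm{dev}_2(\epsilon_2,d_{XZ}),\mathrm{dev}_2(\epsilon_2,d_{YZ})$ and $\sum_{u_0,u_1\in X}\sum_{w_0,w_1\in Y}\sum_{z_0,z_1\in Z}\prod_{(i,j,k)\in\{0,1\}^3}h(u_i,w_j,z_k)\leq\epsilon_1d_{XY}^4d_{XZ}^4d_{YZ}^4|X|^2|Y|^2|Z|^2$, with $h=1-d$ on $\overline{E}\cap K_3(G)$, $-d$ on $K_3(G)\setminus\overline{E}$, $0$ elsewhere. A $(t,\ell)$-decomposition of $V$: partition $\{V_1,\ldots,V_t\}$ and for each $1\leq i,j\leq t$ a partition $V_i\times V_j=P_{ij}^1\cup\cdots\cup P_{ij}^\ell$, with triads $(V_i,V_j,V_k;P_{ij}^\alpha,P_{ik}^\beta,P_{jk}^\gamma)$. It is a $(t,\ell,\epsilon_1,\epsilon_2)$-decomposition if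 for at least $(1-\epsilon_1)|V|^2$ pairs $(x,y)$ the part $P_{ij}^\alpha\ni(x,y)$ makes $(V_i,V_j;P_{ij}^\alpha)$ have $\mathrm{dev}_2(\epsilon_2)$; it is $\mathrm{dev}_{2,3}(\epsilon_1,\epsilon_2)$-regular w.r.t. $H$ if for all but at most $\epsilon_1|V|^3$ triples $(x,y,z)$ the triad $G$ with $(x,y,z)\in K_3(G)$ has $\mathrm{dev}_{2,3}(\epsilon_1,\epsilon_2)$ w.r.t. $H$. $T_{\mathcal{H}}(\epsilon_1,\epsilon_2)$ is the least $T$ for which there are $L\geq1$ and $n_0$ such that every $H\in\mathcal{H}$ on at least $n_0$ vertices has, for some $1\leq t\leq T$, $1\leq\ell\leq L$, a $(t,\ell,\epsilon_1,\epsilon_2(\ell))$-decomposition that is $\mathrm{dev}_{2,3}(\epsilon_1,\epsilon_2(\ell))$-regular w.r.t. $H$. ''Asymptotically, $P(\epsilon_1,\epsilon_2)$'' means: there is $\epsilon^*>0$ such that for every $0<\epsilon_1<\epsilon^*$ there is $\epsilon_2^{(\epsilon_1)}:\mathbb{N}\to(0,1]$ such that $P(\epsilon_1,\epsilon_2)$ holds for all $\epsilon_2:\mathbb{N}\to(0,1]$ with $\epsilon_2\leq\epsilon_2^{(\epsilon_1)}$ pointwise. *)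

(* Defs.v *)
From HB Require Import structures.
From mathcomp Require Import all_boot all_order all_algebra.
From mathcomp Require Import boolp classical_sets reals constructive_ereal ereal exp.
(* Reimported because classical_sets shadows partition, pblock, setX, ... *)
From mathcomp Require Import finset.

Set Implicit Arguments.
Unset Strict Implicit.
Unset Printing Implicit Defensive.

Import Order.TTheory GRing.Theory Num.Theory.

Local Open Scope set_scope.
Local Open Scope ring_scope.

(** * Graphs and 3-graphs *)

Record graph := Graph {
  gvert :> finType;
  gedges : {set {set gvert}};
  gedges_card : forall e, e \in gedges -> #|e| = 2 }.

Record graph3 := Graph3 {
  vert :> finType;
  edges : {set {set vert}};
  edges_card : forall e, e \in edges -> #|e| = 3 }.

Definition iso3 (H H' : graph3) : Prop :=
  exists2 f : H -> H', bijective f &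
    forall e : {set H}, (e \in edges H) = (f @: e \in edges H').

Section Induced.
Variables (H : graph3) (A : {set H}).

Definition induced_edges : {set {set {x : H | x \in A}}} :=
  [set e : {set {x : H | x \in A}} | val @: e \in edges H].

Lemma induced_edges_card (e : {set {x : H | x \in A}}) :
  e \in induced_edges -> #|e| = 3.
Proof. by rewrite inE => /edges_card; rewrite card_imset //; apply: val_inj. Qed.

Definition induced : graph3 := Graph3 induced_edges_card.

End Induced.

Definition hereditary (C : graph3 -> Prop) : Prop :=
  (forall H H' : graph3, iso3 H H' -> C H -> C H') /\
  (forall (H : graph3) (A : {set H}), C H -> C (induced A)).

Inductive hereditary_closure (C : graph3 -> Prop) : graph3 -> Prop :=
| Closure_base (H : graph3) : C H -> hereditary_closure C H
| Closure_iso (H H' : graph3) :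
    iso3 H H' -> hereditary_closure C H -> hereditary_closure C H'
| Closure_induced (H : graph3) (A : {set H}) :
    hereditary_closure C H -> hereditary_closure C (induced A).

Lemma cards3_neq (T : finType) (x y z : T) :
  x != y -> x != z -> y != z -> #|[set x; y; z]| = 3.
Proof.
move=> xy xz yz.
by rewrite setUC cardsU1 cards2 !inE eq_sym negb_or xz eq_sym yz xy.
Qed.

Section Otimes.
Variables (n : nat) (G : graph).

Definition otimes_edges : {set {set (G + 'I_n)%type}} :=
  [set e : {set (G + 'I_n)%type} | [exists x : G, exists y : G, exists z : 'I_n,
     ([set x; y] \in gedges G) && (e == [set inl x; inl y; inr z])]].

Lemma otimes_edges_card (e : {set (G + 'I_n)%type}) : e \in otimes_edges -> #|e| = 3.
Proof.
rewrite inE => /existsP[x /existsP[y /existsP[z /andP[xyE /eqP->]]]].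
apply: cards3_neq => //; have := gedges_card xyE; rewrite cards2.
by apply: contra_eq_neq; case=> ->; rewrite eqxx.
Qed.

Definition otimes : graph3 := Graph3 otimes_edges_card.

End Otimes.

Section PowersetGraph.
Variable k : nat.

Definition U_edges : {set {set ('I_k + {set 'I_k})%type}} :=
  [set e : {set ('I_k + {set 'I_k})%type} | [exists i : 'I_k, exists S : {set 'I_k},
     (i \in S) && (e == [set inl i; inr S])]].

Lemma U_edges_card (e : {set ('I_k + {set 'I_k})%type}) : e \in U_edges -> #|e| = 2.
Proof.
by rewrite inE => /existsP[i /existsP[S /andP[_ /eqP->]]]; rewrite cards2.
Qed.

Definition U_graph : graph := Graph U_edges_card.

End PowersetGraph.

Section Trip.
Variable H : graph3.

Definition Trip_vert : finType := (H + H + H)%type.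
Definition a_ (v : H) : Trip_vert := inl (inl v).
Definition b_ (v : H) : Trip_vert := inl (inr v).
Definition c_ (v : H) : Trip_vert := inr v.

Definition Trip_edges : {set {set Trip_vert}} :=
  [set e : {set Trip_vert} | [exists x : H, exists y : H, exists z : H,
     ([set x; y; z] \in edges H) && (e == [set a_ x; b_ y; c_ z])]].

Lemma Trip_edges_card (e : {set Trip_vert}) : e \in Trip_edges -> #|e| = 3.
Proof.
rewrite inE => /existsP[x /existsP[y /existsP[z /andP[_ /eqP->]]]].
exact: cards3_neq.
Qed.

Definition Trip : graph3 := Graph3 Trip_edges_card.

End Trip.

Definition Trip_class (C : graph3 -> Prop) : graph3 -> Prop :=
  hereditary_closure (fun G => exists2 H, C H & G = Trip H).

(** * Counting, densities, and partitions *)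

Definition npairs (V : finType) (P : V -> V -> Prop) : nat :=
  #|[set t : V * V | `[< P t.1 t.2 >]]|.

Definition ntriples (V : finType) (P : V -> V -> V -> Prop) : nat :=
  #|[set t : V * V * V | `[< P t.1.1 t.1.2 t.2 >]]|.

(** Ordered triples of V^3 are encoded as elements ((x, y), z) of V * V * V. *)
Definition Ebar (H : graph3) : {set H * H * H} :=
  [set t | [set t.1.1; t.1.2; t.2] \in edges H].

(** The partition {A 0, ..., A (n-1)} of D into exactly n nonempty parts. *)
Definition partition_family (T : finType) (n : nat)
    (A : 'I_n -> {set T}) (D : {set T}) : Prop :=
  injective A /\ partition [set A i | i : 'I_n] D.

Section Regularity.
Variable R : realType.

Definition dens (H : graph3) (X Y Z : {set H}) : R :=
  #|Ebar H :&: setX (setX X Y) Z|%:R / (#|X| * #|Y| * #|Z|)%:R.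

Definition homogeneous (H : graph3) (eps : R) (X Y Z : {set H}) : Prop :=
  (0 <= dens X Y Z < eps) || (1 - eps < dens X Y Z <= 1).

Definition weakly_regular (H : graph3) (eps : R) (X Y Z : {set H}) : Prop :=
  forall X' Y' Z' : {set H},
    X' \subset X -> Y' \subset Y -> Z' \subset Z ->
    eps * #|X|%:R <= #|X'|%:R -> eps * #|Y|%:R <= #|Y'|%:R ->
    eps * #|Z|%:R <= #|Z'|%:R ->
    `|dens X' Y' Z' - dens X Y Z| <= eps.

Definition homogeneous_partition
    (H : graph3) (eps : R) (P : {set {set H}}) : Prop :=
  partition P [set: H] /\
  (1 - eps) * #|H|%:R ^+ 3 <= (ntriples (fun x y z =>
     homogeneous eps (pblock P x) (pblock P y) (pblock P z)))%:R.

Definition weakly_regular_partition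
    (H : graph3) (eps : R) (P : {set {set H}}) : Prop :=
  partition P [set: H] /\
  (1 - eps) * #|H|%:R ^+ 3 <= (ntriples (fun x y z =>
     weakly_regular eps (pblock P x) (pblock P y) (pblock P z)))%:R.

(** * Bigraphs and triads *)

(** A bigraph (U, W; E) inside V x V is given by sets U, W and E, the latter
    being a subset of [setX U W] in all uses. *)
Definition bidens (V : finType) (U W : {set V}) (E : {set V * V}) : R :=
  #|E|%:R / (#|U| * #|W|)%:R.

Definition dev2 (V : finType) (eps d : R)
    (U W : {set V}) (E : {set V * V}) : Prop :=
  let g u w := if (u, w) \in E then 1 - bidens U W E else - bidens U W E in
  `|bidens U W E - d| <= eps /\
  \sum_(u0 in U) \sum_(u1 in U) \sum_(w0 in W) \sum_(w1 in W)
     g u0 w0 * g u0 w1 * g u1 w0 * g u1 w1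
  <= eps * #|U|%:R ^+ 2 * #|W|%:R ^+ 2.

Definition dev2_self (V : finType) (eps : R)
    (U W : {set V}) (E : {set V * V}) : Prop :=
  dev2 eps (bidens U W E) U W E.

Record triad (V : finType) := Triad {
  tX : {set V}; tY : {set V}; tZ : {set V};
  tXY : {set V * V}; tXZ : {set V * V}; tYZ : {set V * V} }.

Definition K3 (V : finType) (G : triad V) : {set V * V * V} :=
  [set t | [&& (t.1.1, t.1.2) \in tXY G, (t.1.1, t.2) \in tXZ G
             & (t.1.2, t.2) \in tYZ G]].

Definition triad_dens (H : graph3) (G : triad H) : R :=
  #|Ebar H :&: K3 G|%:R / #|K3 G|%:R.

Definition triad_h (H : graph3) (G : triad H) (x y z : H) : R :=
  if (x, y, z) \in K3 G
  then (if (x, y, z) \in Ebar H then 1 - triad_dens G else - triad_dens G)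
  else 0.

Definition dev23 (H : graph3) (eps1 eps2 : R) (G : triad H) : Prop :=
  let h := triad_h G in
  exists dXY dXZ dYZ : R,
    [/\ 0 < dXY, 0 < dXZ & 0 < dYZ] /\
    [/\ dev2 eps2 dXY (tX G) (tY G) (tXY G),
        dev2 eps2 dXZ (tX G) (tZ G) (tXZ G)
      & dev2 eps2 dYZ (tY G) (tZ G) (tYZ G)] /\
    \sum_(u0 in tX G) \sum_(u1 in tX G)
    \sum_(w0 in tY G) \sum_(w1 in tY G)
    \sum_(z0 in tZ G) \sum_(z1 in tZ G)
       h u0 w0 z0 * h u0 w0 z1 * h u0 w1 z0 * h u0 w1 z1 *
       h u1 w0 z0 * h u1 w0 z1 * h u1 w1 z0 * h u1 w1 z1
    <= eps1 * dXY ^+ 4 * dXZ ^+ 4 * dYZ ^+ 4 *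
       #|tX G|%:R ^+ 2 * #|tY G|%:R ^+ 2 * #|tZ G|%:R ^+ 2.

(** * Decompositions *)

Record decomposition (V : finType) (t l : nat) := Decomposition {
  vpart : 'I_t -> {set V};
  epart : 'I_t -> 'I_t -> 'I_l -> {set V * V};
  vpartP : partition_family vpart [set: V];
  epartP : forall i j, partition_family (epart i j) (setX (vpart i) (vpart j)) }.

Definition dtriad (V : finType) (t l : nat) (D : decomposition V t l)
    (i j k : 'I_t) (a b c : 'I_l) : triad V :=
  Triad (vpart D i) (vpart D j) (vpart D k)
        (epart D i j a) (epart D i k b) (epart D j k c).

Definition dev2_decomposition (V : finType) (t l : nat) (eps1 eps2 : R)
    (D : decomposition V t l) : Prop :=
  (1 - eps1) * #|V|%:R ^+ 2 <= (npairs (fun x y =>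
     exists i j a, (x, y) \in epart D i j a /\
       dev2_self eps2 (vpart D i) (vpart D j) (epart D i j a)))%:R.

Definition dev23_regular (H : graph3) (t l : nat) (eps1 eps2 : R)
    (D : decomposition H t l) : Prop :=
  (ntriples (fun x y z =>
     ~ exists i j k a b c, (x, y, z) \in K3 (dtriad D i j k a b c) /\
         dev23 eps1 eps2 (dtriad D i j k a b c)))%:R
  <= eps1 * #|H|%:R ^+ 3.

(** * Growth functions *)

(** The least natural number satisfying P (the infimum is attained when P is
    satisfiable), with value +oo if there is none. *)
Definition least_nat (P : nat -> Prop) : \bar R :=
  ereal_inf [set (m%:R)%:E | m in [set m | P m]]%classic.

Definition M_hom (C : graph3 -> Prop) (eps : R) : \bar R :=
  least_nat (fun M => exists n0 : nat, forall H : graph3, C H -> (n0 <= #|H|)%N ->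
    exists2 P : {set {set H}}, homogeneous_partition eps P & (#|P| <= M)%N).

Definition M_weak (C : graph3 -> Prop) (eps : R) : \bar R :=
  least_nat (fun M => exists n0 : nat, forall H : graph3, C H -> (n0 <= #|H|)%N ->
    exists2 P : {set {set H}}, weakly_regular_partition eps P & (#|P| <= M)%N).

Definition T_ (C : graph3 -> Prop) (eps1 : R) (eps2 : nat -> R) : \bar R :=
  least_nat (fun T => exists L n0 : nat, (1 <= L)%N /\
    forall H : graph3, C H -> (n0 <= #|H|)%N ->
    exists t l : nat, [/\ (1 <= t <= T)%N, (1 <= l <= L)%N &
      exists D : decomposition H t l,
        dev2_decomposition eps1 (eps2 l) D /\ dev23_regular eps1 (eps2 l) D]).

Definition asymptotically (P : R -> (nat -> R) -> Prop) : Prop :=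
  exists2 eps_star : R, 0 < eps_star &
  forall eps1 : R, 0 < eps1 < eps_star ->
  exists2 eps2_star : nat -> R, (forall n, 0 < eps2_star n <= 1) &
  forall eps2 : nat -> R, (forall n, 0 < eps2 n <= 1) ->
    (forall n, eps2 n <= eps2_star n) -> P eps1 eps2.

End Regularity.

(* Main.v *)
(** Upper bound: if [(X, Y, Z)] is homogeneous, then the triad of complete
    bigraphs on it is regular, because its octahedron sum is at most
    [|X||Y||Z|] times the sum of [|h|], which is [2 d (1 - d) |X||Y||Z|]. So a
    homogeneous partition is a regular decomposition with [l = 1].

    Lower bound: the vertex partition of a regular decomposition is weakly
    regular. Cauchy-Schwarz relative to the quasirandom component bigraphs turns
    the octahedron bound into [|sum h f g w| <= eps1^(1/8) p q r |X||Y||Z|], up to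
    an [eps2] error, for weights bounded by 1; here the gain [p q r] is essential,
    since the densities of the cells of [X x Y x Z] then add up to 1 and the
    total error does not depend on [l]. Counting triangles in each triad, the
    number of edges in any sub-box is therefore [d |X'||Y'||Z'|] up to
    [O(delta^5) |X||Y||Z|] with [d] independent of the box and
    [delta = eps1^(1/40)], unless irregular triads cover too much of
    [X x Y x Z], which by Markov's inequality concerns few triples of parts. *)

Require Import Defs.
From mathcomp Require Import all_boot all_order all_algebra.
From mathcomp Require Import ring lra.
From mathcomp Require Import boolp classical_sets reals constructive_ereal ereal exp.
From mathcomp Require Import finset.

Set Implicit Arguments.
Unset Strict Implicit.
Unset Printing Implicit Defensive.

Import Order.TTheory GRing.Theory Num.Theory.

Local Open Scope ring_scope.

(** * Cut norm and counting in bigraphs *)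

Section CauchySchwarz.
Variable R : realFieldType.

Lemma cauchy_schwarz (I : finType) (P : pred I) (a b : I -> R) :
  (\sum_(i | P i) a i * b i) ^+ 2 <=
  (\sum_(i | P i) a i ^+ 2) * (\sum_(i | P i) b i ^+ 2).
Proof.
set S := \sum_(i | P i) _; set A := \sum_(i | P i) _; set B := \sum_(i | P i) _.
(* Lagrange's identity: the sum of squares equals [2 * (A * B - S ^+ 2)]. *)
suff: \sum_(i | P i) \sum_(j | P j) (a i * b j - a j * b i) ^+ 2
      = A * B + B * A - (S * S + S * S).
  have : 0 <= \sum_(i | P i) \sum_(j | P j) (a i * b j - a j * b i) ^+ 2.
    by apply: sumr_ge0 => i _; apply: sumr_ge0 => j _; apply: sqr_ge0.
  by move=> h e; move: h; rewrite e expr2 [B * A]mulrC; lra.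
rewrite /A /B /S !big_distrlr /= -!big_split -sumrB /=.
apply: eq_bigr => i _; rewrite -!big_split -sumrB /=.
by apply: eq_bigr => j _; ring.
Qed.

Lemma cauchy_schwarz2 (I J : finType) (P : pred I) (Q : pred J)
    (a b : I -> J -> R) :
  (\sum_(i | P i) \sum_(j | Q j) a i j * b i j) ^+ 2 <=
  (\sum_(i | P i) \sum_(j | Q j) a i j ^+ 2) *
  (\sum_(i | P i) \sum_(j | Q j) b i j ^+ 2).
Proof. by rewrite !pair_big /=; apply: cauchy_schwarz. Qed.

Lemma cauchy_schwarz3 (I J K : finType) (P : pred I) (Q : pred J) (S : pred K)
    (a b : I -> J -> K -> R) :
  (\sum_(i | P i) \sum_(j | Q j) \sum_(k | S k) a i j k * b i j k) ^+ 2 <=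
  (\sum_(i | P i) \sum_(j | Q j) \sum_(k | S k) a i j k ^+ 2) *
  (\sum_(i | P i) \sum_(j | Q j) \sum_(k | S k) b i j k ^+ 2).
Proof. by rewrite !pair_big /=; apply: cauchy_schwarz. Qed.

Lemma cauchy_schwarz4 (I J K L : finType) (P : pred I) (Q : pred J)
    (S : pred K) (T : pred L) (a b : I -> J -> K -> L -> R) :
  (\sum_(i | P i) \sum_(j | Q j) \sum_(k | S k) \sum_(l | T l)
      a i j k l * b i j k l) ^+ 2 <=
  (\sum_(i | P i) \sum_(j | Q j) \sum_(k | S k) \sum_(l | T l) a i j k l ^+ 2) *
  (\sum_(i | P i) \sum_(j | Q j) \sum_(k | S k) \sum_(l | T l) b i j k l ^+ 2).
Proof.
by rewrite !pair_big /=; apply: cauchy_schwarz.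
Qed.

Lemma sum_constE (I : finType) (A : {set I}) (c : R) :
  \sum_(i in A) c = c * #|A|%:R.
Proof. by rewrite sumr_const mulr_natr. Qed.

Lemma sum_le_const (I : finType) (A : {set I}) (F : I -> R) (b : R) :
  (forall i, i \in A -> F i <= b) -> \sum_(i in A) F i <= b * #|A|%:R.
Proof.
move=> Fb; apply: le_trans (ler_sum _ Fb) _.
by rewrite sum_constE.
Qed.

Lemma norm_sum_le_const (I : finType) (A : {set I}) (F : I -> R) (b : R) :
  (forall i, i \in A -> `|F i| <= b) -> `|\sum_(i in A) F i| <= b * #|A|%:R.
Proof.
by move=> Fb; apply: le_trans (ler_norm_sum _ _ _) _; apply: sum_le_const.
Qed.

Lemma sqr_le1 (x : R) : `|x| <= 1 -> x ^+ 2 <= 1.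
Proof. by move=> x1; rewrite -real_normK ?num_real// exprn_ile1. Qed.

Lemma norm_le1M (x y : R) : `|x| <= 1 -> `|y| <= 1 -> `|x * y| <= 1.
Proof. by move=> x1 y1; rewrite normrM mulr_ile1. Qed.

Lemma sqrM_le (x y : R) : `|x| <= 1 -> (x * y) ^+ 2 <= y ^+ 2.
Proof. by move=> x1; rewrite exprMn ler_piMl ?sqr_ge0 ?sqr_le1. Qed.

Lemma bool01 (b : bool) : 0 <= (b%:R : R) <= 1.
Proof. by case: b; rewrite ?lexx ?ler01. Qed.

Lemma normr_bool (b : bool) : `|b%:R : R| <= 1.
Proof. by case: b; rewrite ?normr1 ?normr0. Qed.

End CauchySchwarz.

Section Cut.
Variables (R : realFieldType) (I J : finType) (X : {set I}) (Y : {set J}).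

(** The unnormalized fourth power of the Gowers box norm; applied to the indicator minus the density
    it is the sum in [dev2]. *)
Definition C4 (a : I -> J -> R) : R :=
  \sum_(u0 in X) \sum_(u1 in X) \sum_(w0 in Y) \sum_(w1 in Y)
     a u0 w0 * a u0 w1 * a u1 w0 * a u1 w1.

(** Test functions with values in [-1, 1] take the place of subsets, because the counting lemmas
    plug in slices such as [fun x => B x z * f x]. *)
Definition cut_bounded (eta : R) (a : I -> J -> R) : Prop :=
  forall (u : I -> R) (v : J -> R),
    (forall x, `|u x| <= 1) -> (forall y, `|v y| <= 1) ->
    `|\sum_(x in X) \sum_(y in Y) a x y * u x * v y| <= eta * #|X|%:R * #|Y|%:R.

Lemma C4_codegree (a : I -> J -> R) :
  \sum_(y0 in Y) \sum_(y1 in Y) (\sum_(x in X) a x y0 * a x y1) ^+ 2 = C4 a.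
Proof.
rewrite /C4; under [RHS]eq_bigr do rewrite exchange_big /=.
rewrite [RHS]exchange_big /=; apply: eq_bigr => y0 _.
under [RHS]eq_bigr do rewrite exchange_big /=.
rewrite [RHS]exchange_big /=; apply: eq_bigr => y1 _.
rewrite expr2 big_distrlr /=; apply: eq_bigr => x0 _.
by apply: eq_bigr => x1 _; ring.
Qed.

(** Cauchy-Schwarz twice: the first application removes [u] at the cost of [#|X|], the second
    removes [v] and leaves the squared codegrees [M y0 y1], whose sum is [C4 a]. Together the fourth
    power of the cut sum is at most [#|X| ^ 2 * #|Y| ^ 2 * C4 a]. *)
Lemma C4_cut_bounded (eta : R) (a : I -> J -> R) : 0 <= eta ->
  C4 a <= eta ^+ 4 * #|X|%:R ^+ 2 * #|Y|%:R ^+ 2 -> cut_bounded eta a.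
Proof.
move=> eta0 aC4 u v u1 v1.
pose T x := \sum_(y in Y) a x y * v y.
pose M y0 y1 := \sum_(x in X) a x y0 * a x y1.
set S := \sum_(x in X) _.
have S2 : S ^+ 2 <= #|X|%:R * \sum_(x in X) T x ^+ 2.
  have -> : S = \sum_(x in X) u x * T x.
    apply: eq_bigr => x _; rewrite mulr_sumr; apply: eq_bigr => y _; ring.
  apply: le_trans (cauchy_schwarz _ _ _) _.
  apply: ler_wpM2r; first by apply: sumr_ge0 => x _; apply: sqr_ge0.
  by rewrite -[leRHS]mul1r; apply: sum_le_const => x _; apply: sqr_le1.
have T2 : (\sum_(x in X) T x ^+ 2) ^+ 2 <= #|Y|%:R ^+ 2 * C4 a.
  have -> : \sum_(x in X) T x ^+ 2
      = \sum_(y0 in Y) \sum_(y1 in Y) (v y0 * v y1) * M y0 y1.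
    under eq_bigr do rewrite expr2 big_distrlr /=.
    rewrite exchange_big /=; apply: eq_bigr => y0 _.
    rewrite exchange_big /=; apply: eq_bigr => y1 _.
    by rewrite mulr_sumr; apply: eq_bigr => x _; ring.
  apply: le_trans (cauchy_schwarz2 _ _ _ _) _.
  rewrite -C4_codegree; apply: ler_wpM2r.
    by apply: sumr_ge0 => y0 _; apply: sumr_ge0 => y1 _; apply: sqr_ge0.
  rewrite expr2; apply: sum_le_const => y0 _.
  rewrite -[leRHS]mul1r; apply: sum_le_const => y1 _.
  by rewrite sqr_le1 ?norm_le1M.
rewrite -(@ler_pXn2r _ 4) ?nnegrE ?mulr_ge0//.
rewrite -normrX ger0_norm; last by rewrite (exprM _ 2 2) sqr_ge0.
rewrite (exprM _ 2 2).
apply: le_trans (_ : (#|X|%:R * \sum_(x in X) T x ^+ 2) ^+ 2 <= _).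
  by rewrite ler_pXn2r ?nnegrE ?sqr_ge0// mulr_ge0// sumr_ge0// => x _; apply: sqr_ge0.
rewrite exprMn; apply: le_trans (ler_wpM2l _ T2) _; first exact: sqr_ge0.
rewrite mulrA; apply: le_trans (ler_wpM2l _ aC4) _; first by rewrite mulr_ge0 ?sqr_ge0.
by rewrite le_eqVlt; apply/orP; left; apply/eqP; ring.
Qed.

End Cut.

Section FourCycle.
Variables (R : realFieldType) (I J : finType) (X : {set I}) (Y : {set J}).

(** The edges of the 4-cycle carry separate functions so that they can be replaced one at a time;
    the two swaps below bring any edge to the first position. *)
Definition mixed_C4 (a b c d : I -> J -> R) : R :=
  \sum_(x0 in X) \sum_(x1 in X) \sum_(y0 in Y) \sum_(y1 in Y)
     a x0 y0 * b x0 y1 * c x1 y0 * d x1 y1.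

Lemma mixed_C4_swapl a b c d : mixed_C4 a b c d = mixed_C4 c d a b.
Proof.
rewrite /mixed_C4 exchange_big; do 4![apply: eq_bigr => ? _ /=]; ring.
Qed.

Lemma mixed_C4_swapr a b c d : mixed_C4 a b c d = mixed_C4 b a d c.
Proof.
rewrite /mixed_C4; do 2![apply: eq_bigr => ? _ /=].
by rewrite exchange_big; do 2![apply: eq_bigr => ? _ /=]; ring.
Qed.

Lemma mixed_C4B a a' b c d :
  mixed_C4 a b c d = mixed_C4 (fun x y => a x y - a' x y) b c d + mixed_C4 a' b c d.
Proof.
by rewrite /mixed_C4; do 4![rewrite -big_split; apply: eq_bigr => ? _ /=]; ring.
Qed.

(** Once [x1] and [y1] are fixed, [d] is a constant, [b] depends on [x0] alone and [c] on [y0]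
    alone, so what remains is a cut sum of [a]. *)
Lemma mixed_C4_cut_le (eta : R) (a b c d : I -> J -> R) :
  cut_bounded X Y eta a -> (forall x y, `|b x y| <= 1) ->
  (forall x y, `|c x y| <= 1) -> (forall x y, `|d x y| <= 1) ->
  mixed_C4 a b c d <= eta * #|X|%:R ^+ 2 * #|Y|%:R ^+ 2.
Proof.
move=> acut b1 c1 d1; apply: le_trans (ler_norm _) _.
have -> : mixed_C4 a b c d = \sum_(x1 in X) \sum_(y1 in Y)
    d x1 y1 * \sum_(x0 in X) \sum_(y0 in Y) a x0 y0 * b x0 y1 * c x1 y0.
  rewrite /mixed_C4 exchange_big /=; apply: eq_bigr => x1 _.
  under eq_bigr do rewrite exchange_big /=.
  rewrite exchange_big /=; apply: eq_bigr => y1 _.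
  rewrite mulr_sumr; apply: eq_bigr => x0 _.
  by rewrite mulr_sumr; apply: eq_bigr => y0 _; ring.
rewrite [leRHS](_ : _ = eta * #|X|%:R * #|Y|%:R * #|Y|%:R * #|X|%:R); last by ring.
apply: norm_sum_le_const => x1 _; apply: norm_sum_le_const => y1 _.
rewrite normrM; apply: le_trans (acut (fun x => b x y1) (c x1) _ _) => //.
exact: ler_piMl.
Qed.

End FourCycle.

Section BigraphCount.
Variables (R : realFieldType) (I J : finType) (X : {set I}) (Y : {set J}).
Variables (A : I -> J -> R) (q eta : R).
Hypothesis A01 : forall x y, 0 <= A x y <= 1.
Hypothesis q01 : 0 <= q <= 1.
Hypothesis Acut : cut_bounded X Y eta (fun x y => A x y - q).

Let A1 x y : `|A x y| <= 1.
Proof. by rewrite ler_norml; have := A01 x y; lra. Qed.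

Let q1 : `|q| <= 1. Proof. by rewrite ler_norml; move: q01; lra. Qed.

Let one1 : `|1 : R| <= 1. Proof. by rewrite normr1. Qed.

(** Splits [A x y0 * A x y1] as [(A x y0 - q) * A x y1 + q * (A x y1 - q) + q ^+ 2]. With [y1] fixed
    in the first term and [y0] in the second, both are cut sums. *)
Lemma cherry_count_le :
  \sum_(x in X) \sum_(y0 in Y) \sum_(y1 in Y) A x y0 * A x y1 <=
  (q ^+ 2 + 2 * eta) * #|X|%:R * #|Y|%:R ^+ 2.
Proof.
rewrite [leLHS](_ : _ =
    \sum_(y1 in Y) \sum_(x in X) \sum_(y0 in Y) (A x y0 - q) * A x y1 * 1
    + \sum_(y0 in Y) q * (\sum_(x in X) \sum_(y1 in Y) (A x y1 - q) * 1 * 1)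
    + \sum_(x in X) \sum_(y0 in Y) \sum_(y1 in Y) q ^+ 2); last first.
  under [X in _ = _ + X + _]eq_bigr do rewrite mulr_sumr.
  rewrite [X in _ = X + _ + _]exchange_big [X in _ = _ + X + _]exchange_big.
  rewrite -!big_split; apply: eq_bigr => x _ /=.
  under [X in _ = _ + X + _]eq_bigr do rewrite mulr_sumr.
  rewrite [X in _ = X + _ + _]exchange_big.
  rewrite -!big_split; apply: eq_bigr => y0 _ /=.
  by rewrite -!big_split; apply: eq_bigr => y1 _ /=; ring.
rewrite !sum_constE.
have e1 : \sum_(y1 in Y) \sum_(x in X) \sum_(y0 in Y) (A x y0 - q) * A x y1 * 1
    <= eta * #|X|%:R * #|Y|%:R * #|Y|%:R.
  apply: sum_le_const => y1 _; apply: le_trans (ler_norm _) _.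
  exact: (Acut (u := fun x => A x y1) (v := fun=> 1)).
have e2 : q * (\sum_(x in X) \sum_(y1 in Y) (A x y1 - q) * 1 * 1)
    <= eta * #|X|%:R * #|Y|%:R.
  apply: le_trans (ler_norm _) _; rewrite normrM.
  apply: le_trans (Acut (u := fun=> 1) (v := fun=> 1) _ _) => //.
  exact: ler_piMl.
have := ler_wpM2r (ler0n R #|Y|) e2; move: e1; lra.
Qed.

(** The four edges are changed from [A] to the constant [q] one after the other, and each change
    costs [eta]. *)
Lemma C4_count_le :
  C4 X Y A <= (q ^+ 4 + 4 * eta) * #|X|%:R ^+ 2 * #|Y|%:R ^+ 2.
Proof.
pose Q (x : I) (y : J) := q.
have Q1 x y : `|Q x y| <= 1 by [].
have e (b c d : I -> J -> R) : (forall x y, `|b x y| <= 1) ->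
    (forall x y, `|c x y| <= 1) -> (forall x y, `|d x y| <= 1) ->
    mixed_C4 X Y A b c d <=
      mixed_C4 X Y Q b c d + eta * #|X|%:R ^+ 2 * #|Y|%:R ^+ 2.
  by move=> b1 c1 d1; rewrite (mixed_C4B _ _ A Q) addrC lerD2l; apply: mixed_C4_cut_le.
have QQQQ : mixed_C4 X Y Q Q Q Q = q ^+ 4 * #|X|%:R ^+ 2 * #|Y|%:R ^+ 2.
  by rewrite /mixed_C4 /Q !sum_constE; ring.
have e1 := e A A A A1 A1 A1.
have := e Q A A Q1 A1 A1; rewrite mixed_C4_swapr => e2.
have := e A Q Q A1 Q1 Q1; rewrite mixed_C4_swapl => e3.
have := e Q Q Q Q1 Q1 Q1; rewrite mixed_C4_swapr => e4.
rewrite /C4 -/(mixed_C4 X Y A A A A); move: e1 e2 e3 e4; rewrite QQQQ.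
lra.
Qed.

End BigraphCount.

Section TriangleCount.
Variables (R : realFieldType) (I J K : finType).
Variables (X : {set I}) (Y : {set J}) (Z : {set K}).
Variables (A : I -> J -> R) (B : I -> K -> R) (C : J -> K -> R) (p q r eta : R).
Hypothesis B1 : forall x z, `|B x z| <= 1.
Hypothesis C1 : forall y z, `|C y z| <= 1.
Hypotheses (p1 : `|p| <= 1) (q1 : `|q| <= 1).
Hypothesis Acut : cut_bounded X Y eta (fun x y => A x y - p).
Hypothesis Bcut : cut_bounded X Z eta (fun x z => B x z - q).
Hypothesis Ccut : cut_bounded Y Z eta (fun y z => C y z - r).

(** Telescoping: [A * B * C - p * q * r] is [(A - p) * B * C + p * (B - q) * C + p * q * (C - r)].
    In each term, fixing the vertex opposite to the difference leaves a cut sum; these are [E1],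
    [E2] and [E3]. *)
Lemma triangle_count (f : I -> R) (g : J -> R) (k : K -> R) :
  (forall x, `|f x| <= 1) -> (forall y, `|g y| <= 1) -> (forall z, `|k z| <= 1) ->
  `|\sum_(x in X) \sum_(y in Y) \sum_(z in Z)
       A x y * B x z * C y z * (f x * g y * k z)
    - p * q * r * (\sum_(x in X) f x) * (\sum_(y in Y) g y) * (\sum_(z in Z) k z)|
  <= 3 * eta * #|X|%:R * #|Y|%:R * #|Z|%:R.
Proof.
move=> f1 g1 k1.
pose E1 z := \sum_(x in X) \sum_(y in Y) (A x y - p) * (B x z * f x) * (C y z * g y).
pose E2 y := \sum_(x in X) \sum_(z in Z) (B x z - q) * f x * (C y z * k z).
pose E3 := \sum_(y in Y) \sum_(z in Z) (C y z - r) * g y * k z.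
have -> : p * q * r * (\sum_(x in X) f x) * (\sum_(y in Y) g y) * (\sum_(z in Z) k z)
    = \sum_(x in X) \sum_(y in Y) \sum_(z in Z) p * q * r * (f x * (g y * k z)).
  under [RHS]eq_bigr do under eq_bigr do rewrite -!mulr_sumr.
  under [RHS]eq_bigr do rewrite -!mulr_sumr -mulr_suml.
  by rewrite -mulr_sumr -mulr_suml !mulrA.
rewrite [X in `|X|](_ : _ = \sum_(z in Z) k z * E1 z
    + \sum_(y in Y) (p * g y) * E2 y + \sum_(x in X) (p * q * f x) * E3); last first.
  rewrite /E1 /E2 /E3.
  under [X in _ = X + _ + _]eq_bigr do rewrite mulr_sumr.
  under [X in _ = _ + X + _]eq_bigr do rewrite mulr_sumr.
  rewrite [X in _ = X + _ + _]exchange_big [X in _ = _ + X + _]exchange_big.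
  rewrite -sumrB -!big_split; apply: eq_bigr => x _ /=.
  under [X in _ = X + _ + _]eq_bigr do rewrite mulr_sumr.
  rewrite [X in _ = X + _ + _]exchange_big mulr_sumr /= -sumrB.
  rewrite -!big_split; apply: eq_bigr => y _ /=.
  by rewrite !mulr_sumr -sumrB -!big_split; apply: eq_bigr => z _ /=; ring.
have N1 (x y : R) : `|x| <= 1 -> `|x * y| <= `|y| by move=> ?; rewrite normrM ler_piMl.
have e1 : `|\sum_(z in Z) k z * E1 z| <= eta * #|X|%:R * #|Y|%:R * #|Z|%:R.
  apply: norm_sum_le_const => z _; apply: le_trans (N1 _ _ (k1 z)) _.
  exact: (Acut (u := fun x => B x z * f x) (v := fun y => C y z * g y)
    (fun x => norm_le1M (B1 x z) (f1 x)) (fun y => norm_le1M (C1 y z) (g1 y))).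
have e2 : `|\sum_(y in Y) (p * g y) * E2 y| <= eta * #|X|%:R * #|Z|%:R * #|Y|%:R.
  apply: norm_sum_le_const => y _; apply: le_trans (N1 _ _ (norm_le1M p1 (g1 y))) _.
  exact: (Bcut (v := fun z => C y z * k z) f1 (fun z => norm_le1M (C1 y z) (k1 z))).
have e3 : `|\sum_(x in X) (p * q * f x) * E3| <= eta * #|Y|%:R * #|Z|%:R * #|X|%:R.
  apply: norm_sum_le_const => x _.
  apply: le_trans (N1 _ _ (norm_le1M (norm_le1M p1 q1) (f1 x))) _; exact: Ccut.
apply: le_trans (ler_normD _ _) _; apply: le_trans (lerD (ler_normD _ _) (lexx _)) _.
move: e1 e2 e3; lra.
Qed.

End TriangleCount.

(** * Regular triads *)

Section Octahedron.
Variables (R : realFieldType) (I J K : finType).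
Variables (X : {set I}) (Y : {set J}) (Z : {set K}).

Definition octahedron (h : I -> J -> K -> R) : R :=
  \sum_(u0 in X) \sum_(u1 in X)
  \sum_(w0 in Y) \sum_(w1 in Y)
  \sum_(z0 in Z) \sum_(z1 in Z)
     h u0 w0 z0 * h u0 w0 z1 * h u0 w1 z0 * h u0 w1 z1 *
     h u1 w0 z0 * h u1 w0 z1 * h u1 w1 z0 * h u1 w1 z1.

(** Three applications of Cauchy-Schwarz, each doubling one vertex class. Before each one the
    indicator of a bigraph supporting [h] is split off and kept in the factor without [h]. That
    factor is then the mass of the bigraph instead of the trivial bound, which is where the gain in
    the densities comes from. *)
Lemma octahedron_cauchy_schwarz (h : I -> J -> K -> R)
    (A : I -> J -> R) (B : I -> K -> R) (C : J -> K -> R) :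
  (forall x y z, h x y z = A x y * h x y z) ->
  (forall x y z, h x y z = B x z * h x y z) ->
  (forall x y z, h x y z = C y z * h x y z) ->
  (forall x y, A x y ^+ 2 = A x y) -> (forall x z, B x z ^+ 2 = B x z) ->
  (forall y z, C y z ^+ 2 = C y z) ->
  forall (f : I -> R) (g : J -> R) (k : K -> R),
  (forall x, `|f x| <= 1) -> (forall y, `|g y| <= 1) -> (forall z, `|k z| <= 1) ->
  (\sum_(x in X) \sum_(y in Y) \sum_(z in Z) h x y z * (f x * g y * k z)) ^+ 8 <=
  (\sum_(x in X) \sum_(y in Y) A x y) ^+ 4 *
  (\sum_(x in X) \sum_(z0 in Z) \sum_(z1 in Z) B x z0 * B x z1) ^+ 2 *
  C4 Y Z C * octahedron h.
Proof.
move=> hA hB hC A2 B2 C2 f g k f1 g1 k1.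
set S := \sum_(x in X) _; set sA := \sum_(x in X) _; set sB := \sum_(x in X) _.
pose T x y := \sum_(z in Z) k z * h x y z.
pose Q x z0 z1 := \sum_(y in Y) h x y z0 * h x y z1.
pose W y0 y1 z0 z1 := \sum_(x in X) h x y0 z0 * h x y0 z1 * h x y1 z0 * h x y1 z1.
pose S1 := \sum_(x in X) \sum_(y in Y) T x y ^+ 2.
pose S2 := \sum_(x in X) \sum_(z0 in Z) \sum_(z1 in Z) Q x z0 z1 ^+ 2.
have sA0 : 0 <= sA.
  by apply: sumr_ge0 => x _; apply: sumr_ge0 => y _; rewrite -A2 sqr_ge0.
have sB0 : 0 <= sB.
  do 3![apply: sumr_ge0 => ? _].
  by rewrite mulr_ge0// -B2 sqr_ge0.
have sC0 : 0 <= C4 Y Z C.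
  do 4![apply: sumr_ge0 => ? _].
  by rewrite !mulr_ge0// -C2 sqr_ge0.
have S10 : 0 <= S1 by do 2![apply: sumr_ge0 => ? _]; apply: sqr_ge0.
have S20 : 0 <= S2 by do 3![apply: sumr_ge0 => ? _]; apply: sqr_ge0.
(* Sums over [z] inside; the weights [f] and [g] disappear and [A] is kept. *)
have step1 : S ^+ 2 <= sA * S1.
  have -> : S = \sum_(x in X) \sum_(y in Y) A x y * ((f x * g y) * T x y).
    do 2![apply: eq_bigr => ? _]; rewrite !mulr_sumr; apply: eq_bigr => z _.
    by rewrite [in LHS]hA; ring.
  apply: le_trans (cauchy_schwarz2 _ _ _ _) _.
  have -> : \sum_(x in X) \sum_(y in Y) A x y ^+ 2 = sA.
    by do 2![apply: eq_bigr => ? _].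
  apply: ler_wpM2l => //; do 2![apply: ler_sum => ? _].
  exact/sqrM_le/norm_le1M.
(* The vertex of [Z] is doubled and the sum over [y] moves inside; [k] disappears and [B] is kept on
   both copies of [z]. *)
have step2 : S1 ^+ 2 <= sB * S2.
  have -> : S1 = \sum_(x in X) \sum_(z0 in Z) \sum_(z1 in Z)
      (B x z0 * B x z1) * ((k z0 * k z1) * Q x z0 z1).
    apply: eq_bigr => x _; under eq_bigr do rewrite expr2 big_distrlr /=.
    rewrite exchange_big; apply: eq_bigr => z0 _ /=.
    rewrite exchange_big; apply: eq_bigr => z1 _ /=.
    rewrite !mulr_sumr; apply: eq_bigr => y _.
    by rewrite [h x y z0 in LHS]hB [h x y z1 in LHS]hB; ring.
  apply: le_trans (cauchy_schwarz3 _ _ _ _ _) _.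
  have -> : \sum_(x in X) \sum_(z0 in Z) \sum_(z1 in Z) (B x z0 * B x z1) ^+ 2 = sB.
    by do 3![apply: eq_bigr => ? _]; rewrite exprMn !B2.
  apply: ler_wpM2l => //; do 3![apply: ler_sum => ? _].
  exact/sqrM_le/norm_le1M.
(* The vertex of [Y] is doubled and the sum over [x] moves inside. No weight is left, [C] is kept on
   all four pairs, and squaring [W] doubles the vertex of [X], which completes the octahedron. *)
have step3 : S2 ^+ 2 <= C4 Y Z C * octahedron h.
  have -> : S2 = \sum_(y0 in Y) \sum_(y1 in Y) \sum_(z0 in Z) \sum_(z1 in Z)
      (C y0 z0 * C y0 z1 * C y1 z0 * C y1 z1) * W y0 y1 z0 z1.
    transitivity (\sum_(y0 in Y) \sum_(x in X) \sum_(y1 in Y) \sum_(z0 in Z)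
      \sum_(z1 in Z) h x y0 z0 * h x y0 z1 * (h x y1 z0 * h x y1 z1)).
      rewrite [RHS]exchange_big; apply: eq_bigr => x _ /=.
      transitivity (\sum_(z0 in Z) \sum_(z1 in Z) \sum_(y0 in Y) \sum_(y1 in Y)
        h x y0 z0 * h x y0 z1 * (h x y1 z0 * h x y1 z1)).
        by do 2![apply: eq_bigr => ? _]; rewrite expr2 big_distrlr.
      under [LHS]eq_bigr do rewrite exchange_big /=.
      rewrite [LHS]exchange_big; apply: eq_bigr => y0 _ /=.
      under [LHS]eq_bigr do rewrite exchange_big /=.
      by rewrite [LHS]exchange_big.
    apply: eq_bigr => y0 _; rewrite exchange_big; apply: eq_bigr => y1 _ /=.
    rewrite exchange_big; apply: eq_bigr => z0 _ /=.
    rewrite exchange_big; apply: eq_bigr => z1 _ /=.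
    rewrite mulr_sumr; apply: eq_bigr => x _.
    rewrite [h x y0 z0 in LHS]hC [h x y0 z1 in LHS]hC.
    by rewrite [h x y1 z0 in LHS]hC [h x y1 z1 in LHS]hC; ring.
  apply: le_trans (cauchy_schwarz4 _ _ _ _ _ _) _.
  have -> : \sum_(y0 in Y) \sum_(y1 in Y) \sum_(z0 in Z) \sum_(z1 in Z)
      (C y0 z0 * C y0 z1 * C y1 z0 * C y1 z1) ^+ 2 = C4 Y Z C.
    by do 4![apply: eq_bigr => ? _]; rewrite !exprMn !C2.
  apply: ler_wpM2l => //; rewrite le_eqVlt; apply/orP; left; apply/eqP.
  rewrite /octahedron.
  transitivity (\sum_(y0 in Y) \sum_(y1 in Y) \sum_(x0 in X) \sum_(x1 in X)
      \sum_(z0 in Z) \sum_(z1 in Z)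
      (h x0 y0 z0 * h x0 y0 z1 * h x0 y1 z0 * h x0 y1 z1) *
      (h x1 y0 z0 * h x1 y0 z1 * h x1 y1 z0 * h x1 y1 z1)).
    do 2![apply: eq_bigr => ? _]; under [LHS]eq_bigr do under eq_bigr do
      rewrite expr2 big_distrlr /=.
    under [LHS]eq_bigr do rewrite exchange_big /=.
    rewrite [LHS]exchange_big; apply: eq_bigr => x0 _ /=.
    under [LHS]eq_bigr do rewrite exchange_big /=.
    by rewrite [LHS]exchange_big.
  under [LHS]eq_bigr do rewrite exchange_big /=.
  rewrite [LHS]exchange_big; apply: eq_bigr => x0 _ /=.
  under [LHS]eq_bigr do rewrite exchange_big /=.
  rewrite [LHS]exchange_big; apply: eq_bigr => x1 _ /=.
  by do 4![apply: eq_bigr => ? _]; rewrite !mulrA.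
have sq (a b : R) : 0 <= a -> a <= b -> a ^+ 2 <= b ^+ 2.
  by move=> a0 ab; rewrite ler_pXn2r// nnegrE// (le_trans a0).
rewrite (exprM _ 2 4) (exprM _ 2 2).
apply: le_trans (sq _ _ (sqr_ge0 _) (sq _ _ (sqr_ge0 _) step1)) _.
rewrite [leLHS](_ : _ = sA ^+ 4 * (S1 ^+ 2) ^+ 2); last by ring.
rewrite [leRHS](_ : _ = sA ^+ 4 * (sB ^+ 2 * (C4 Y Z C * octahedron h))); last by ring.
apply: ler_wpM2l; first exact: exprn_ge0.
apply: le_trans (sq _ _ (sqr_ge0 _) step2) _.
by rewrite exprMn; apply: ler_wpM2l; first exact: sqr_ge0.
Qed.

End Octahedron.

Section Bigraph.
Variables (R : realType) (V : finType) (X Y : {set V}) (E : {set V * V}).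
Hypothesis EXY : E \subset setX X Y.

Lemma sum_bigraph : \sum_(x in X) \sum_(y in Y) ((x, y) \in E)%:R = #|E|%:R :> R.
Proof.
rewrite pair_big /= -sum1_card natr_sum [RHS]big_mkcond [LHS]big_mkcond /=.
apply: eq_bigr => -[x y] _ /=; case: ifP => [_|xy]; first by case: ifP.
by case: ifP => // /(fintype.subsetP EXY); rewrite in_setX xy.
Qed.

Lemma bidensE : bidens R X Y E * #|X|%:R * #|Y|%:R = #|E|%:R.
Proof.
rewrite -mulrA -natrM /bidens.
(* If a side is empty, the quotient is 0 by convention, and [E] is empty too. *)
have [XY0|XY0] := eqVneq (#|X| * #|Y|)%N 0.
  have := subset_leq_card EXY; rewrite cardsX XY0 leqn0 => /eqP ->.
  by rewrite !mul0r.
by rewrite divfK// pnatr_eq0.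
Qed.

Lemma bidens01 : 0 <= bidens R X Y E <= 1.
Proof.
rewrite divr_ge0//=.
have [XY0|XY0] := eqVneq (#|X| * #|Y|)%N 0; first by rewrite /bidens XY0 invr0 mulr0.
by rewrite /bidens ler_pdivrMr ?ltr0n ?lt0n// mul1r ler_nat -cardsX subset_leq_card.
Qed.

Lemma dev2_cut_bounded (eps d eta : R) : 0 <= eta -> eps <= eta ^+ 4 ->
  dev2 eps d X Y E ->
  cut_bounded X Y eta (fun x y => ((x, y) \in E)%:R - bidens R X Y E).
Proof.
move=> eta0 epseta [_ gC4]; apply: C4_cut_bounded => //.
apply: le_trans (_ : _ <= eps * #|X|%:R ^+ 2 * #|Y|%:R ^+ 2) _; last first.
  by rewrite !ler_wpM2r ?sqr_ge0.
apply: le_trans gC4; rewrite le_eqVlt; apply/orP; left; apply/eqP.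
have gE x y : (if (x, y) \in E then 1 - bidens R X Y E else - bidens R X Y E)
    = ((x, y) \in E)%:R - bidens R X Y E by case: ifP => _; rewrite ?sub0r.
by do 4![apply: eq_bigr => ? _]; rewrite !gE.
Qed.

End Bigraph.

Lemma triad_dens01 (R : realType) (H : graph3) (G : triad H) :
  0 <= triad_dens R G <= 1.
Proof.
rewrite divr_ge0//=; have [K0|K0] := posnP #|K3 G|.
  by rewrite /triad_dens K0 invr0 mulr0.
by rewrite ler_pdivrMr ?ltr0n// mul1r ler_nat subset_leq_card// subsetIr.
Qed.

(** With [eps2 <= zeta ^+ 16] the component bigraphs have cut norm at most
    [zeta ^+ 4], and this error in the C4 and cherry counts is absorbed by
    replacing a density [p] with [p + 2 * zeta]. *)
Section RegularTriad.
Variables (R : realType) (H : graph3) (G : triad H).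
Hypotheses (XYsub : tXY G \subset setX (tX G) (tY G))
  (XZsub : tXZ G \subset setX (tX G) (tZ G))
  (YZsub : tYZ G \subset setX (tY G) (tZ G)).
Variables (eps1 eps2 kappa zeta : R).
Hypotheses (zeta01 : 0 <= zeta <= 1) (kappa0 : 0 <= kappa).
Hypotheses (eps1_le : eps1 <= kappa ^+ 8) (eps2_le : eps2 <= zeta ^+ 16).
Hypothesis Greg : dev23 eps1 eps2 G.

Let p := bidens R (tX G) (tY G) (tXY G).
Let q := bidens R (tX G) (tZ G) (tXZ G).
Let r := bidens R (tY G) (tZ G) (tYZ G).
Let N : R := #|tX G|%:R * #|tY G|%:R * #|tZ G|%:R.

Let zeta4 : 0 <= zeta ^+ 4. Proof. by apply: exprn_ge0; case/andP: zeta01. Qed.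
Let eps2_le4 : eps2 <= (zeta ^+ 4) ^+ 4. Proof. by rewrite -exprM. Qed.

(** The indicator of [K3 G] is the product of those of the three bigraphs, so this is
    [triangle_count] with cut error [zeta ^+ 4]. *)
Lemma regular_triad_triangles (f g k : H -> R) :
  (forall x, `|f x| <= 1) -> (forall y, `|g y| <= 1) -> (forall z, `|k z| <= 1) ->
  `|\sum_(x in tX G) \sum_(y in tY G) \sum_(z in tZ G)
      ((x, y, z) \in K3 G)%:R * (f x * g y * k z)
    - p * q * r * (\sum_(x in tX G) f x) * (\sum_(y in tY G) g y)
      * (\sum_(z in tZ G) k z)| <= 3 * zeta ^+ 4 * N.
Proof.
move=> f1 g1 k1; have [dXY [dXZ [dYZ [_ [[dev1 dev2 dev3] _]]]]] := Greg.
have n1 (X Y : {set H}) (E : {set H * H}) : E \subset setX X Y -> `|bidens R X Y E| <= 1.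
  by move=> EXY; have /andP[b0 b1] := bidens01 R EXY; rewrite ger0_norm.
have := triangle_count (A := fun x y => ((x, y) \in tXY G)%:R)
  (B := fun x z => ((x, z) \in tXZ G)%:R) (C := fun y z => ((y, z) \in tYZ G)%:R)
  (fun x z => @normr_bool R _) (fun y z => @normr_bool R _) (n1 _ _ _ XYsub) (n1 _ _ _ XZsub)
  (dev2_cut_bounded zeta4 eps2_le4 dev1) (dev2_cut_bounded zeta4 eps2_le4 dev2)
  (dev2_cut_bounded zeta4 eps2_le4 dev3) f1 g1 k1.
rewrite -/p -/q -/r /N -!mulrA; congr (`|_ - _| <= _).
do 3![apply: eq_bigr => ? _]; rewrite inE /=.
by do 3!case: (_ \in _); rewrite ?(mul0r, mul1r).
Qed.

(** Eighth root of [octahedron_cauchy_schwarz]: the edge, cherry and 4-cycle counts bound the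
    bigraph factors, and [dev23] bounds the octahedron. *)
Lemma regular_triad_deviation (f g k : H -> R) :
  (forall x, `|f x| <= 1) -> (forall y, `|g y| <= 1) -> (forall z, `|k z| <= 1) ->
  `|\sum_(x in tX G) \sum_(y in tY G) \sum_(z in tZ G)
      triad_h R G x y z * (f x * g y * k z)|
  <= kappa * ((p + 2 * zeta) * (q + 2 * zeta) * (r + 2 * zeta)) * N.
Proof.
move=> f1 g1 k1.
have [dXY [dXZ [dYZ [[d10 d20 d30] [[dev1 dev2 dev3] oct]]]]] := Greg.
set S := \sum_(x in _) _.
have [/andP[p0 p1] /andP[q0 q1] /andP[r0 r1]] :
    [/\ 0 <= p <= 1, 0 <= q <= 1 & 0 <= r <= 1] by split; apply: bidens01.
have [zeta0 zeta1] := andP zeta01.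
pose A x y : R := ((x, y) \in tXY G)%:R.
pose B x z : R := ((x, z) \in tXZ G)%:R.
pose C y z : R := ((y, z) \in tYZ G)%:R.
have idem (b : bool) : b%:R ^+ 2 = b%:R :> R by case: b; rewrite ?expr1n ?expr0n.
have hA x y z : triad_h R G x y z = A x y * triad_h R G x y z.
  by rewrite /triad_h /A inE /=; case: (_ \in tXY G); rewrite ?mul1r ?mul0r.
have hB x y z : triad_h R G x y z = B x z * triad_h R G x y z.
  rewrite /triad_h /B inE /= andbCA; case: (_ \in tXZ G); rewrite ?mul1r ?mul0r//.
have hC x y z : triad_h R G x y z = C y z * triad_h R G x y z.
  rewrite /triad_h /C inE /= andbA andbC; case: (_ \in tYZ G); rewrite ?mul1r ?mul0r//.
have := octahedron_cauchy_schwarz (tX G) (tY G) (tZ G) hA hB hC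
  (fun x y => idem _) (fun x y => idem _) (fun x y => idem _) f1 g1 k1.
rewrite -/S sum_bigraph// -(bidensE R XYsub) -/p => S8.
have cB := cherry_count_le (A := B) (fun x z => @bool01 R _) (bidens01 R XZsub)
  (dev2_cut_bounded zeta4 eps2_le4 dev2).
have cC := C4_count_le (A := C) (fun x z => @bool01 R _) (bidens01 R YZsub)
  (dev2_cut_bounded zeta4 eps2_le4 dev3).
rewrite -/q in cB; rewrite -/r in cC.
have z20 : 0 <= 2 * zeta by rewrite mulr_ge0.
have zeta_z4 : zeta ^+ 4 <= zeta ^+ 2 by apply: ler_wiXn2l.
(* The densities [dXY], [dXZ], [dYZ] provided by [dev23] exceed the true ones by at most [eps2], so
   the same shift by [2 * zeta] covers them. *)
have eps2_zeta : eps2 <= 2 * zeta.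
  by apply: le_trans eps2_le _; apply: le_trans (_ : zeta ^+ 1 <= _);
    [apply: ler_wiXn2l|rewrite expr1; lra].
have d_le b d : 0 < d -> `|b - d| <= eps2 -> 0 <= b -> d ^+ 4 <= (b + 2 * zeta) ^+ 4.
  move=> d0 bd b0; rewrite ler_pXn2r ?nnegrE ?addr_ge0 ?(ltW d0)//.
  by move: bd; rewrite ler_norml; lra.
have e1 := d_le _ _ d10 dev1.1 p0; have e2 := d_le _ _ d20 dev2.1 q0.
have e3 := d_le _ _ d30 dev3.1 r0; rewrite -/p -/q -/r in e1 e2 e3.
have P4 : p ^+ 4 <= (p + 2 * zeta) ^+ 4 by rewrite ler_pXn2r ?nnegrE ?addr_ge0 ?lerDl.
have Q2 : q ^+ 2 + 2 * zeta ^+ 4 <= (q + 2 * zeta) ^+ 2.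
  by have := mulr_ge0 q0 zeta0; have := sqr_ge0 zeta; move: zeta_z4; rewrite sqrrD; nra.
have R4 : r ^+ 4 + 4 * zeta ^+ 4 <= (r + 2 * zeta) ^+ 4.
  rewrite [leRHS](_ : _ = r ^+ 4 + 8 * (r ^+ 3 * zeta) + 24 * (r ^+ 2 * zeta ^+ 2)
    + 32 * (r * zeta ^+ 3) + 16 * zeta ^+ 4); last by ring.
  have t1 : 0 <= r ^+ 3 * zeta by rewrite mulr_ge0 ?exprn_ge0.
  have t2 : 0 <= r ^+ 2 * zeta ^+ 2 by rewrite mulr_ge0 ?exprn_ge0.
  have t3 : 0 <= r * zeta ^+ 3 by rewrite mulr_ge0 ?exprn_ge0.
  by move: zeta4; lra.
move: p0 q0 r0 P4 Q2 R4 e1 e2 e3 cB cC S8 oct; rewrite /N.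
move: p q r => a b c; set P := a + _; set Q := b + _; set T := c + _.
set x : R := #|tX G|%:R; set y : R := #|tY G|%:R; set z : R := #|tZ G|%:R.
have [x0 y0 z0] : [/\ 0 <= x, 0 <= y & 0 <= z] by split; apply: ler0n.
set sB := \sum_(_ in _) _; set sC := C4 _ _ _; set oc := octahedron _ _ _ _.
move=> a0 b0 c0 P4 Q2 R4 e1 e2 e3 cB cC S8 oct.
have P0 : 0 <= P by rewrite /P; lra.
have Q0 : 0 <= Q by rewrite /Q; lra.
have T0 : 0 <= T by rewrite /T; lra.
have sB0 : 0 <= sB by do 3![apply: sumr_ge0 => ? _]; rewrite mulr_ge0.
have sC0 : 0 <= sC by do 4![apply: sumr_ge0 => ? _]; rewrite !mulr_ge0.
have cB' : sB ^+ 2 <= (Q ^+ 2 * x * z ^+ 2) ^+ 2.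
  rewrite ler_pXn2r ?nnegrE ?mulr_ge0 ?sqr_ge0//.
  by apply: le_trans cB _; rewrite !ler_wpM2r ?sqr_ge0.
have cC' : sC <= T ^+ 4 * y ^+ 2 * z ^+ 2.
  by apply: le_trans cC _; rewrite !ler_wpM2r ?sqr_ge0.
have oc' : oc <= kappa ^+ 8 * P ^+ 4 * Q ^+ 4 * T ^+ 4 * x ^+ 2 * y ^+ 2 * z ^+ 2.
  apply: le_trans oct _; rewrite !ler_wpM2r ?sqr_ge0//.
  have [dX0 dY0 dZ0] : [/\ 0 <= dXY ^+ 4, 0 <= dXZ ^+ 4 & 0 <= dYZ ^+ 4].
    by split; apply/exprn_ge0/ltW.
  have k8 : 0 <= kappa ^+ 8 by exact: exprn_ge0.
  apply: le_trans (_ : kappa ^+ 8 * dXY ^+ 4 * dXZ ^+ 4 * dYZ ^+ 4 <= _).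
    by rewrite !ler_wpM2r.
  apply: ler_pM => //; first exact: (mulr_ge0 (mulr_ge0 k8 dX0) dY0).
  by apply: ler_pM => //; [exact: mulr_ge0|apply: ler_wpM2l].
have pxy : (a * x * y) ^+ 4 <= (P * x * y) ^+ 4.
  by rewrite !exprMn; do 2![apply: ler_wpM2r; first exact: exprn_ge0].
have pxy0 : 0 <= (a * x * y) ^+ 4 by rewrite exprn_ge0 ?mulr_ge0.
rewrite -(@ler_pXn2r _ 8) ?nnegrE ?mulr_ge0//.
rewrite -normrX ger0_norm; last by rewrite (exprM _ 2 4) exprn_ge0 ?sqr_ge0.
apply: le_trans S8 _.
have M0 : 0 <= (a * x * y) ^+ 4 * sB ^+ 2 * sC by rewrite !mulr_ge0 ?sqr_ge0.
apply: le_trans (ler_wpM2l M0 oc') _.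
(* The exponents balance: in the product of the four bounds each of [kappa], [P], [Q], [T], [x],
   [y], [z] occurs to the eighth power. *)
apply: le_trans (ler_wpM2r _ (_ : _ <= (P * x * y) ^+ 4
    * (Q ^+ 2 * x * z ^+ 2) ^+ 2 * (T ^+ 4 * y ^+ 2 * z ^+ 2))) _.
- by rewrite !mulr_ge0 ?exprn_ge0.
- apply: ler_pM => //; first by rewrite mulr_ge0 ?sqr_ge0.
  by apply: ler_pM => //; apply: sqr_ge0.
by rewrite le_eqVlt; apply/orP; left; apply/eqP; ring.
Qed.

End RegularTriad.

(** * Weak regularity from a regular decomposition *)

Section PartitionFamily.
Variables (R : realType) (T : finType) (n : nat) (A : 'I_n -> {set T}) (D : {set T}).
Hypothesis AD : partition_family A D.

Lemma partition_family_uniq i j x : x \in A i -> x \in A j -> i = j.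
Proof.
have [injA /and3P[_ /trivIsetP tA _]] := AD => xi xj.
apply/injA/eqP; apply: contraT => ij.
have := tA _ _ (imset_f _ (isT : i \in 'I_n)) (imset_f _ (isT : j \in 'I_n)) ij.
by move/disjointFr => /(_ _ xi); rewrite xj.
Qed.

Lemma mem_partition_family x : (x \in D) = [exists i, x \in A i].
Proof.
have [_ /and3P[/eqP <- _ _]] := AD; apply/bigcupP/existsP.
  by move=> [_ /imsetP[i _ ->] xi]; exists i.
by move=> [i xi]; exists (A i) => //; apply: imset_f.
Qed.

Lemma partition_family_sub i : A i \subset D.
Proof.
by apply/fintype.subsetP => x xi; rewrite mem_partition_family; apply/existsP; exists i.
Qed.

Lemma partition_family_neq0 i : A i != set0.
Proof.
have [_ /and3P[_ _ A0]] := AD.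
by apply: contra A0 => /eqP <-; apply: imset_f.
Qed.

Lemma partition_family_card : #|[set A i | i : 'I_n]| = n.
Proof. by rewrite card_imset ?card_ord//; case: AD. Qed.

Lemma partition_family_pblock i x :
  x \in A i -> pblock [set A i | i : 'I_n] x = A i.
Proof.
have [_ /and3P[_ tA _]] := AD => xi.
by apply: def_pblock => //; apply: imset_f.
Qed.

Lemma sum_partition_family x : \sum_i (x \in A i)%:R = (x \in D)%:R :> R.
Proof.
rewrite mem_partition_family; case: existsP => [[i xi]|nx].
  rewrite (bigD1 i)//= xi big1 ?addr0// => j ji.
  by case: (boolP (x \in A j)) => // xj; rewrite (partition_family_uniq xi xj) eqxx in ji.
by rewrite big1// => i _; case: (boolP (x \in A i)) => // xi; case: nx; exists i.
Qed.

End PartitionFamily.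

Section Decomposition.
Variables (R : realType) (H : graph3) (t l : nat) (D : decomposition H t l).
Variables (eps1 eps2 kappa zeta : R).
Hypotheses (zeta01 : 0 <= zeta <= 1) (kappa0 : 0 <= kappa).
Hypotheses (eps1_le : eps1 <= kappa ^+ 8) (eps2_le : eps2 <= zeta ^+ 16).

Definition in_regular_triad (x y z : H) : Prop :=
  exists i j k a b c, (x, y, z) \in K3 (dtriad D i j k a b c) /\
    dev23 eps1 eps2 (dtriad D i j k a b c).

(** The condition counted by [dev23_regular], made boolean so that it can be summed. *)
Definition irregular (x y z : H) : bool := `[< ~ in_regular_triad x y z >].

(** Parts and cells are disjoint, so a triple determines its triad. Hence every triple of a triad
    that fails [dev23] is irregular. *)
Lemma dtriad_uniq i j k a b c i' j' k' a' b' c' x y z :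
  (x, y, z) \in K3 (dtriad D i j k a b c) ->
  (x, y, z) \in K3 (dtriad D i' j' k' a' b' c') ->
  dtriad D i j k a b c = dtriad D i' j' k' a' b' c'.
Proof.
have sub u v s m : m \in epart D u v s -> m.1 \in vpart D u /\ m.2 \in vpart D v.
  move/(fintype.subsetP (partition_family_sub (epartP D u v) s)).
  by case: m => m1 m2; rewrite in_setX => /andP.
rewrite !inE /= => /and3P[xy xz yz] /and3P[xy' xz' yz'].
have [/= xi yj] := sub _ _ _ _ xy; have [/= _ zk] := sub _ _ _ _ xz.
have [/= xi' yj'] := sub _ _ _ _ xy'; have [/= _ zk'] := sub _ _ _ _ xz'.
have ei := partition_family_uniq (vpartP D) xi xi'.
have ej := partition_family_uniq (vpartP D) yj yj'.
have ek := partition_family_uniq (vpartP D) zk zk'.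
subst i' j' k'.
by rewrite (partition_family_uniq (epartP _ _ _) xy xy')
  (partition_family_uniq (epartP _ _ _) xz xz') (partition_family_uniq (epartP _ _ _) yz yz').
Qed.

Variables i j k : 'I_t.
Let X := vpart D i.
Let Y := vpart D j.
Let Z := vpart D k.
Let N : R := #|X|%:R * #|Y|%:R * #|Z|%:R.

Definition irregular_mass : R :=
  \sum_(x in X) \sum_(y in Y) \sum_(z in Z) (irregular x y z)%:R.

Let edge (u v : 'I_t) (a : 'I_l) : R := bidens R (vpart D u) (vpart D v) (epart D u v a).

(** This normalization keeps the total main error over all cells from growing with [l]. *)
Lemma sum_bidens u v : \sum_a edge u v a = 1.
Proof.
have n0 : (#|vpart D u| * #|vpart D v|)%:R != 0 :> R.
  by rewrite pnatr_eq0 muln_eq0 !cards_eq0 !(negbTE (partition_family_neq0 (vpartP D) _)).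
rewrite /edge /bidens -mulr_suml; apply: (canLR (mulfK n0)); rewrite mul1r.
under eq_bigr do rewrite -sum1_card natr_sum big_mkcond /=.
rewrite exchange_big -cardsX -sum1_card natr_sum [RHS]big_mkcond /=.
apply: eq_bigr => m _; have := sum_partition_family R (epartP D u v) m.
under eq_bigr do rewrite -mulrb.
by move=> ->; rewrite mulrb.
Qed.

Section Cell.
Variables a b c : 'I_l.
Let G := dtriad D i j k a b c.

(** The value 0 is a placeholder: the triples of an irregular triad are charged to the irregular
    term of [cell_estimate]. *)
Definition cell_dens : R := if `[< dev23 eps1 eps2 G >] then triad_dens R G else 0.

(** In a regular triad, the edge indicator on [K3 G] is [triad_h] plus the density: the first part
    gives the [kappa] term, the second the triangle-counting error. In any other triad all triples
    are irregular and the trivial bound 1 per triple suffices. *)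
Lemma cell_estimate (f g w : H -> R) :
  (forall x, `|f x| <= 1) -> (forall y, `|g y| <= 1) -> (forall z, `|w z| <= 1) ->
  `|\sum_(x in X) \sum_(y in Y) \sum_(z in Z)
      ((x, y, z) \in K3 G)%:R * (((x, y, z) \in Ebar H)%:R * (f x * g y * w z))
    - cell_dens * (edge i j a * edge i k b * edge j k c)
      * ((\sum_(x in X) f x) * (\sum_(y in Y) g y) * (\sum_(z in Z) w z))|
  <= kappa * ((edge i j a + 2 * zeta) * (edge i k b + 2 * zeta)
              * (edge j k c + 2 * zeta)) * N
     + 3 * zeta ^+ 4 * N
     + \sum_(x in X) \sum_(y in Y) \sum_(z in Z)
         ((x, y, z) \in K3 G)%:R * (irregular x y z)%:R.
Proof.
move=> f1 g1 w1; have sub u v s := partition_family_sub (epartP D u v) s.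
have [zeta0 zeta1] := andP zeta01.
have edge0 u v s : 0 <= edge u v s by case/andP: (bidens01 R (sub u v s)).
have N0 : 0 <= N by rewrite !mulr_ge0.
have phi1 x y z : `|f x * g y * w z| <= 1 by rewrite !norm_le1M.
rewrite /cell_dens; case: asboolP => reg.
  have := regular_triad_deviation (G := G) (sub i j a) (sub i k b) (sub j k c)
    zeta01 kappa0 eps1_le eps2_le reg f1 g1 w1.
  have := regular_triad_triangles (G := G) (sub i j a) (sub i k b)
    zeta01 eps2_le reg f1 g1 w1.
  rewrite -/G /= -/X -/Y -/Z -/N -/(edge i j a) -/(edge i k b) -/(edge j k c).
  set tri := \sum_(x in _) _; set F := \sum_(x in _) _.
  set F' := \sum_(y in _) _; set F'' := \sum_(z in _) _.
  set dvt := \sum_(x in _) _ => tri_le dvt_le.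
  have dens01 := triad_dens01 R G.
  have -> : \sum_(x in X) \sum_(y in Y) \sum_(z in Z)
      ((x, y, z) \in K3 G)%:R * (((x, y, z) \in Ebar H)%:R * (f x * g y * w z))
      = dvt + triad_dens R G * tri.
    rewrite /dvt /tri; do 3![rewrite mulr_sumr -big_split; apply: eq_bigr => ? _ /=].
    by rewrite /triad_h; case: ifP => _ /=; [case: ifP => _ /=|]; ring.
  rewrite [X in `|X|](_ : _ = dvt + triad_dens R G
      * (tri - edge i j a * edge i k b * edge j k c * F * F' * F'')); last by ring.
  rewrite -[leLHS]addr0 lerD//; last by do 3![apply: sumr_ge0 => ? _]; rewrite mulr_ge0.
  apply: le_trans (ler_normD _ _) _; rewrite lerD// normrM.
  apply: le_trans tri_le; apply: ler_piMl => //.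
  by rewrite ger0_norm; case/andP: dens01.
rewrite !mul0r subr0 -[leLHS]add0r lerD//.
  by rewrite addr_ge0// !mulr_ge0// ?exprn_ge0// addr_ge0// mulr_ge0.
do 3![apply: le_trans (ler_norm_sum _ _ _) _; apply: ler_sum => ? _].
rewrite !normrM; case: (boolP (_ \in K3 G)) => inK; last by rewrite normr0 !mul0r.
rewrite normr1 !mul1r /irregular asboolT.
  by rewrite -!normrM norm_le1M ?normr_bool.
move=> [i' [j' [k' [a' [b' [c' [inK' reg']]]]]]]; apply: reg.
by rewrite /G (dtriad_uniq inK inK').
Qed.

End Cell.

(** The triple sum factors into three sums over the cells of one pair each, and every pair lies in
    exactly one cell. *)
Lemma sum_K3 x y z : x \in X -> y \in Y -> z \in Z ->
  \sum_a \sum_b \sum_c ((x, y, z) \in K3 (dtriad D i j k a b c))%:R = 1 :> R.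
Proof.
move=> xX yY zZ.
have e u v m n : m \in vpart D u -> n \in vpart D v ->
    \sum_a ((m, n) \in epart D u v a)%:R = 1 :> R.
  by move=> mu nv; rewrite (sum_partition_family _ (epartP D u v)) in_setX mu nv.
rewrite -[RHS](e _ _ _ _ xX yY); apply: eq_bigr => a _.
rewrite -[RHS]mulr1 -[X in _ = _ * X](e _ _ _ _ xX zZ) mulr_sumr; apply: eq_bigr => b _.
rewrite -[RHS]mulr1 -[X in _ = _ * X](e _ _ _ _ yY zZ) mulr_sumr; apply: eq_bigr => c _.
by rewrite inE /=; do 3!case: (_ \in _); rewrite /= ?(mulr0, mul0r, mulr1).
Qed.

Lemma sum_cells (F : H -> H -> H -> R) :
  \sum_a \sum_b \sum_c \sum_(x in X) \sum_(y in Y) \sum_(z in Z)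
    ((x, y, z) \in K3 (dtriad D i j k a b c))%:R * F x y z
  = \sum_(x in X) \sum_(y in Y) \sum_(z in Z) F x y z.
Proof.
have ex (S : {set H}) (P : 'I_l -> 'I_l -> 'I_l -> H -> R) :
    \sum_a \sum_b \sum_c \sum_(x in S) P a b c x
    = \sum_(x in S) \sum_a \sum_b \sum_c P a b c x.
  rewrite [RHS]exchange_big; apply: eq_bigr => a _ /=.
  rewrite [RHS]exchange_big; apply: eq_bigr => b _ /=.
  exact: exchange_big.
rewrite ex; apply: eq_bigr => x xX; rewrite ex; apply: eq_bigr => y yY.
rewrite ex; apply: eq_bigr => z zZ.
under eq_bigr do under eq_bigr do rewrite -mulr_suml.
under eq_bigr do rewrite -mulr_suml.
by rewrite -mulr_suml sum_K3// mul1r.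
Qed.

Lemma box_estimate : exists d : R, forall f g w : H -> R,
  (forall x, `|f x| <= 1) -> (forall y, `|g y| <= 1) -> (forall z, `|w z| <= 1) ->
  `|\sum_(x in X) \sum_(y in Y) \sum_(z in Z)
      ((x, y, z) \in Ebar H)%:R * (f x * g y * w z)
    - d * ((\sum_(x in X) f x) * (\sum_(y in Y) g y) * (\sum_(z in Z) w z))|
  <= kappa * (1 + 2 * zeta * l%:R) ^+ 3 * N + 3 * zeta ^+ 4 * l%:R ^+ 3 * N
     + irregular_mass.
Proof.
(* The density predicted from the cells: triad densities weighted by products of edge densities. It
   is fixed before the weights, so it serves all sub-boxes at once. *)
exists (\sum_a \sum_b \sum_c cell_dens a b c * (edge i j a * edge i k b * edge j k c)).
move=> f g w f1 g1 w1.
rewrite -sum_cells /irregular_mass -sum_cells.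
set FGW := (\sum_(x in X) f x) * _ * _; rewrite mulr_suml -sumrB.
(* Over all cells the [kappa] term factors into three sums of shifted edge densities, each
   [1 + 2 * zeta * l], while the counting error is multiplied by the [l ^ 3] cells. *)
have -> : kappa * (1 + 2 * zeta * l%:R) ^+ 3 * N + 3 * zeta ^+ 4 * l%:R ^+ 3 * N
    = \sum_a \sum_b \sum_c (kappa * ((edge i j a + 2 * zeta) * (edge i k b + 2 * zeta)
              * (edge j k c + 2 * zeta)) * N + 3 * zeta ^+ 4 * N).
  have e u v : \sum_a (edge u v a + 2 * zeta) = 1 + 2 * zeta * l%:R.
    by rewrite big_split /= sum_bidens sumr_const card_ord mulr_natr.
  have cst (x : R) : \sum_(a < l) x = x * l%:R.
    by rewrite sumr_const card_ord mulr_natr.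
  under [RHS]eq_bigr do under eq_bigr do
    rewrite big_split /= cst -mulr_suml -mulr_sumr -mulr_sumr e.
  under [RHS]eq_bigr do
    rewrite big_split /= cst -mulr_suml -mulr_sumr -mulr_suml -mulr_sumr e.
  rewrite big_split /= cst -mulr_suml -mulr_sumr -mulr_suml -mulr_suml e; ring.
rewrite -big_split; apply: le_trans (ler_norm_sum _ _ _) _; apply: ler_sum => a _ /=.
rewrite -big_split mulr_suml -sumrB; apply: le_trans (ler_norm_sum _ _ _) _.
apply: ler_sum => b _ /=.
rewrite -big_split mulr_suml -sumrB; apply: le_trans (ler_norm_sum _ _ _) _.
apply: ler_sum => c _ /=; exact: cell_estimate.
Qed.

End Decomposition.

Lemma sum_mem_subset (R : realType) (T : finType) (A B : {set T}) : A \subset B ->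
  \sum_(x in B) (x \in A)%:R = #|A|%:R :> R.
Proof.
move=> AB; rewrite -sum1_card natr_sum big_mkcond [RHS]big_mkcond.
apply: eq_bigr => x _; case: ifP => [_|xB]; first by case: (x \in A).
by case: ifP => // /(fintype.subsetP AB); rewrite xB.
Qed.

Lemma card_Ebar_box (R : realType) (H : graph3) (X Y Z X' Y' Z' : {set H}) :
  X' \subset X -> Y' \subset Y -> Z' \subset Z ->
  #|Ebar H :&: setX (setX X' Y') Z'|%:R
  = \sum_(x in X) \sum_(y in Y) \sum_(z in Z)
      ((x, y, z) \in Ebar H)%:R * ((x \in X')%:R * (y \in Y')%:R * (z \in Z')%:R) :> R.
Proof.
move=> XX YY ZZ; rewrite !pair_big /= -sum1_card natr_sum big_mkcond [RHS]big_mkcond.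
apply: eq_bigr => -[[x y] z] _ /=; rewrite in_setI !in_setX /=.
have XXx := fintype.subsetP XX x; have YYy := fintype.subsetP YY y.
have ZZz := fintype.subsetP ZZ z; move: XXx YYy ZZz.
by do 3![case: (boolP (_ \in _)) => [_ /(_ isT) -> | _ _]];
  case: (_ \in Ebar H) => /=; rewrite ?(mulr1, mulr0, mul0r)//; case: ifP.
Qed.

Lemma sum_box (R : realType) (H : graph3) (t l : nat) (D : decomposition H t l)
    (c : H -> 'I_t) (i j k : 'I_t)
    (F : H -> H -> H -> R) :
  (forall x u, (x \in vpart D u) = (c x == u)) ->
  \sum_(p : H * H * H | (c p.1.1, c p.1.2, c p.2) == (i, j, k)) F p.1.1 p.1.2 p.2
  = \sum_(x in vpart D i) \sum_(y in vpart D j) \sum_(z in vpart D k) F x y z.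
Proof.
move=> cP; rewrite !pair_big /=.
by apply: eq_bigl => -[[x y] z] /=; rewrite !cP.
Qed.

Section WeaklyRegular.
Variables (R : realType) (H : graph3) (t l : nat) (D : decomposition H t l).
Variables (delta eps1 eps2 zeta : R).
Hypotheses (delta0 : 0 < delta) (delta1 : 20 * delta <= 1).
Hypotheses (zeta01 : 0 <= zeta <= 1) (zetal : 2 * zeta * l%:R <= 1).
Hypothesis zetal3 : 3 * zeta ^+ 4 * l%:R ^+ 3 <= delta ^+ 5.
Hypotheses (eps1_le : eps1 <= (delta ^+ 5) ^+ 8) (eps2_le : eps2 <= zeta ^+ 16).

(** [box_estimate] is applied to indicators with [kappa = delta ^+ 5]. A sub-box with sides of
    proportion at least [delta] has at least [delta ^+ 3] of the volume, so an error of order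
    [delta ^+ 5] in the count is one of order [delta ^+ 2] in the density. *)
Lemma weakly_regular_box i j k :
  irregular_mass D eps1 eps2 i j k
    <= delta ^+ 5 * (#|vpart D i|%:R * #|vpart D j|%:R * #|vpart D k|%:R) ->
  weakly_regular delta (vpart D i) (vpart D j) (vpart D k).
Proof.
move=> mass.
have d50 : 0 <= delta ^+ 5 by apply/exprn_ge0/ltW.
have [d dP] := box_estimate D zeta01 d50 eps1_le eps2_le i j k.
set X := vpart D i in mass dP *; set Y := vpart D j in mass dP *.
set Z := vpart D k in mass dP *.
have gt0 u : 0 < #|vpart D u|%:R :> R.
  by rewrite ltr0n card_gt0 (partition_family_neq0 (vpartP D)).
have [x0 y0 z0] : [/\ 0 < #|X|%:R :> R, 0 < #|Y|%:R :> R & 0 < #|Z|%:R :> R].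
  by split; apply: gt0.
have main (X' Y' Z' : {set H}) : X' \subset X -> Y' \subset Y -> Z' \subset Z ->
    delta * #|X|%:R <= #|X'|%:R -> delta * #|Y|%:R <= #|Y'|%:R ->
    delta * #|Z|%:R <= #|Z'|%:R -> `|dens R X' Y' Z' - d| <= 10 * delta ^+ 2.
  move=> XX YY ZZ leX leY leZ.
  have := dP (fun x => (x \in X')%:R) (fun x => (x \in Y')%:R) (fun x => (x \in Z')%:R)
    (fun=> normr_bool R _) (fun=> normr_bool R _) (fun=> normr_bool R _).
  rewrite -card_Ebar_box// !sum_mem_subset// /dens !natrM.
  move: x0 y0 z0 leX leY leZ mass.
  set x : R := #|X|%:R; set y : R := #|Y|%:R; set z : R := #|Z|%:R.
  set x' : R := #|X'|%:R; set y' : R := #|Y'|%:R; set z' : R := #|Z'|%:R.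
  set e : R := #|_|%:R; set m := irregular_mass _ _ _ _ _ _.
  move=> x0 y0 z0 leX leY leZ mass est.
  have [dx dy dz] : [/\ 0 < delta * x, 0 < delta * y & 0 < delta * z].
    by split; apply: mulr_gt0.
  have x'0 : 0 < x' by apply: lt_le_trans leX.
  have y'0 : 0 < y' by apply: lt_le_trans leY.
  have z'0 : 0 < z' by apply: lt_le_trans leZ.
  have n'0 : 0 < x' * y' * z' by rewrite !mulr_gt0.
  have -> : e / (x' * y' * z') - d = (e - d * (x' * y' * z')) / (x' * y' * z').
    by rewrite mulrBl mulfK// gt_eqF.
  rewrite normrM [X in _ * X]gtr0_norm ?invr_gt0// ler_pdivrMr//.
  apply: le_trans est _.
  (* The constant 10 is 8 from [(1 + 2 * zeta * l) ^+ 3], plus 1 from [zetal3] and 1 from the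
     irregular mass. *)
  apply: le_trans (_ : _ <= 10 * delta ^+ 5 * (x * y * z)) _.
    have N0 : 0 <= x * y * z by rewrite !mulr_ge0// ltW.
    have c8 : (1 + 2 * zeta * l%:R) ^+ 3 <= 8.
      rewrite [leRHS](_ : _ = 2 ^+ 3); last by ring.
      rewrite ler_pXn2r ?nnegrE//; first by move: zetal; lra.
      by case/andP: zeta01 => z1 _; rewrite addr_ge0// !mulr_ge0.
    have t1 := ler_wpM2r N0 (ler_wpM2l d50 c8).
    have t2 := ler_wpM2r N0 zetal3.
    by move: t1 t2 mass; lra.
  rewrite [leLHS](_ : _ = 10 * delta ^+ 2 * (delta * x * (delta * y) * (delta * z)));
    last by ring.
  apply: ler_wpM2l; first by rewrite mulr_ge0 ?sqr_ge0.
  have [dx' dy' dz'] := And3 (ltW dx) (ltW dy) (ltW dz).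
  by apply: ler_pM => //; [exact: mulr_ge0|exact: ler_pM].
move=> X' Y' Z' XX YY ZZ leX leY leZ.
have m1 := main _ _ _ XX YY ZZ leX leY leZ.
have le1 (a : R) : 0 < a -> delta * a <= a.
  by move=> a0; rewrite ler_piMl ?ltW//; move: delta1 delta0; lra.
have m2 := main _ _ _ (subxx X) (subxx Y) (subxx Z) (le1 _ x0) (le1 _ y0) (le1 _ z0).
have -> : dens R X' Y' Z' - dens R X Y Z
    = (dens R X' Y' Z' - d) - (dens R X Y Z - d) by ring.
apply: le_trans (ler_normB _ _) _; apply: le_trans (lerD m1 m2) _.
(* Both densities are within [10 * delta ^+ 2] of [d], and [20 * delta ^+ 2 <= delta]. *)
by move: (ler_wpM2r (ltW delta0) delta1); rewrite expr2; lra.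
Qed.

End WeaklyRegular.

Lemma ntriples_sum (R : realType) (V : finType) (P : V -> V -> V -> Prop) :
  (ntriples P)%:R = \sum_(p : V * V * V) (`[< P p.1.1 p.1.2 p.2 >])%:R :> R.
Proof.
rewrite /ntriples -sum1_card natr_sum big_mkcond /=; apply: eq_bigr => p _.
by rewrite inE; case: asboolP.
Qed.

Lemma ntriplesC (R : realType) (V : finType) (P : V -> V -> V -> Prop) :
  (ntriples P)%:R + (ntriples (fun x y z => ~ P x y z))%:R = #|V|%:R ^+ 3 :> R.
Proof.
rewrite !ntriples_sum -big_split /=.
transitivity (\sum_(p : V * V * V) 1 : R).
  by apply: eq_bigr => p _; rewrite asbool_neg; case: asboolP; rewrite ?addr0 ?add0r.
by rewrite sumr_const !card_prod natrM natrM; ring.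
Qed.

Section VertexPartition.
Variables (R : realType) (H : graph3) (t l : nat) (D : decomposition H t l).
Variables (delta eps1 eps2 zeta : R).
Hypotheses (delta0 : 0 < delta) (delta1 : 20 * delta <= 1).
Hypotheses (zeta01 : 0 <= zeta <= 1) (zetal : 2 * zeta * l%:R <= 1).
Hypothesis zetal3 : 3 * zeta ^+ 4 * l%:R ^+ 3 <= delta ^+ 5.
Hypotheses (eps1_le : eps1 <= (delta ^+ 5) ^+ 8) (eps2_le : eps2 <= zeta ^+ 16).

Lemma vertex_partition_weakly_regular : dev23_regular eps1 eps2 D ->
  weakly_regular_partition delta [set vpart D i | i : 'I_t].
Proof.
move=> reg; split; first by case: (vpartP D).
have : forall x, exists i, x \in vpart D i.
  by move=> x; apply/existsP; rewrite -(mem_partition_family (vpartP D)) inE.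
move=> /choice[c cV].
have cP x u : (x \in vpart D u) = (c x == u).
  by apply/idP/eqP => [|<-]; [exact: (partition_family_uniq (vpartP D) (cV x))|exact: cV].
have blockE x : pblock [set vpart D i | i : 'I_t] x = vpart D (c x).
  exact: (partition_family_pblock (vpartP D) (cV x)).
set W := fun x y z => weakly_regular delta _ _ _.
have d50 : 0 < delta ^+ 5 by apply: exprn_gt0.
(* Markov's inequality: a box that is not weakly regular has irregular proportion at least
   [delta ^+ 5]. Dividing by [delta ^+ 5] is affordable because
   [eps1 <= delta ^+ 40 <= delta ^+ 6]. *)
suff bad : (ntriples (fun x y z => ~ W x y z))%:R * delta ^+ 5 <= eps1 * #|H|%:R ^+ 3.
  have := ntriplesC R W => tot.
  suff : (ntriples (fun x y z => ~ W x y z))%:R <= delta * #|H|%:R ^+ 3 by move: tot; lra.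
  rewrite -(ler_pM2r d50); apply: le_trans bad _.
  rewrite mulrAC ler_wpM2r ?exprn_ge0//; apply: le_trans eps1_le _.
  rewrite -exprS -exprM; apply: ler_wiXn2l => //; first exact: ltW.
  by move: delta1 delta0; lra.
apply: le_trans reg; rewrite !ntriples_sum mulr_suml.
(* Both counts are grouped by the boxes of parts and compared box by box. *)
rewrite (partition_big (fun p : H * H * H => (c p.1.1, c p.1.2, c p.2)) xpredT)//=.
rewrite [leRHS](partition_big (fun p : H * H * H => (c p.1.1, c p.1.2, c p.2)) xpredT)//=.
apply: ler_sum => -[[i j] k] _.
rewrite (@sum_box R H t l D c i j k (fun x y z => (irregular D eps1 eps2 x y z)%:R) cP).
have [wr|nwr] := pselect (weakly_regular delta (vpart D i) (vpart D j) (vpart D k)).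
  rewrite big1; first by do 3![apply: sumr_ge0 => ? _].
  move=> [[x y] z] /= /eqP[ci cj ck].
  by rewrite asboolF ?mul0r// /W !blockE ci cj ck => /(_ wr).
have : delta ^+ 5 * (#|vpart D i|%:R * #|vpart D j|%:R * #|vpart D k|%:R)
    <= irregular_mass D eps1 eps2 i j k.
  rewrite leNgt; apply/negP => /ltW mass; apply: nwr.
  exact: (weakly_regular_box delta0 delta1 zeta01 zetal zetal3 eps1_le eps2_le).
apply: le_trans.
rewrite (@sum_box R H t l D c i j k (fun x y z => `[< ~ W x y z >]%:R * delta ^+ 5) cP).
rewrite [leRHS](_ : _ = delta ^+ 5 * #|vpart D k|%:R * #|vpart D j|%:R
  * #|vpart D i|%:R); last by ring.
do 3![apply: sum_le_const => ? _].
by case: asboolP => _; rewrite ?mul1r ?mul0r// ltW.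
Qed.

End VertexPartition.

(** * Regular decompositions from a homogeneous partition *)

Section CompleteTriads.
Variables (R : realType) (H : graph3).

Definition complete_triad (X Y Z : {set H}) : triad H :=
  Triad X Y Z (setX X Y) (setX X Z) (setX Y Z).

Lemma bidens_complete (V : finType) (X Y : {set V}) :
  X != set0 -> Y != set0 -> bidens R X Y (setX X Y) = 1.
Proof.
move=> X0 Y0; rewrite /bidens cardsX divff// pnatr_eq0 muln_eq0 !cards_eq0.
by rewrite (negbTE X0) (negbTE Y0).
Qed.

(** The density is 1, so [g] vanishes on [X] times [Y]. *)
Lemma dev2_complete (V : finType) (eps : R) (X Y : {set V}) :
  X != set0 -> Y != set0 -> 0 <= eps -> dev2 eps 1 X Y (setX X Y).
Proof.
move=> X0 Y0 eps0; rewrite /dev2 bidens_complete// subrr normr0; split => //.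
rewrite big1 ?mulr_ge0 ?sqr_ge0// => u0 u0X; rewrite big1// => u1 _.
rewrite big1// => w0 w0Y; rewrite big1// => w1 _.
by rewrite in_setX u0X w0Y !mul0r.
Qed.

Lemma triad_h_le1 (G : triad H) x y z : `|triad_h R G x y z| <= 1.
Proof.
have /andP[d0 d1] := triad_dens01 R G; rewrite /triad_h.
by do 2?[case: ifP => _]; rewrite ler_norml; lra.
Qed.

(** Seven of the eight factors are bounded by 1. The remaining [h u0 w0 z0] leaves [u1], [w1], [z1]
    free, and they contribute the product of the sizes. *)
Lemma octahedron_le_norm (X Y Z : {set H}) (h : H -> H -> H -> R) :
  (forall x y z, `|h x y z| <= 1) ->
  octahedron X Y Z h <= #|X|%:R * #|Y|%:R * #|Z|%:R
    * \sum_(x in X) \sum_(y in Y) \sum_(z in Z) `|h x y z|.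
Proof.
move=> h1.
have -> : #|X|%:R * #|Y|%:R * #|Z|%:R
      * \sum_(x in X) \sum_(y in Y) \sum_(z in Z) `|h x y z|
    = \sum_(x in X) (\sum_(y in Y) (\sum_(z in Z) `|h x y z| * #|Z|%:R)
                                   * #|Y|%:R) * #|X|%:R.
  under [RHS]eq_bigr do under eq_bigr do rewrite -mulr_suml.
  under [RHS]eq_bigr do rewrite -!mulr_suml.
  by rewrite -!mulr_suml; ring.
have le_norm (a b c : R) : `|b| <= 1 -> `|a| <= c -> `|a * b| <= c.
  by move=> b1; apply: le_trans; rewrite normrM ler_piMr.
do 3![apply: ler_sum => ? _; apply: sum_le_const => ? _].
by apply: le_trans (ler_norm _) _; do 7![apply: (le_norm); first exact: h1].
Qed.

Lemma K3_complete (X Y Z : {set H}) : K3 (complete_triad X Y Z) = setX (setX X Y) Z.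
Proof.
apply/setP => -[[x y] z]; rewrite !inE /=.
by case: (x \in X); case: (y \in Y); case: (z \in Z).
Qed.

(** The normalized sum of [|h|] is [2 * d * (1 - d)], and homogeneity makes [d] or [1 - d] smaller
    than [eps]; the three densities are taken to be 1. *)
Lemma homogeneous_dev23 (eps eps1 eps2 : R) (X Y Z : {set H}) :
  X != set0 -> Y != set0 -> Z != set0 -> 2 * eps <= eps1 -> 0 <= eps2 ->
  homogeneous eps X Y Z -> dev23 eps1 eps2 (complete_triad X Y Z).
Proof.
move=> X0 Y0 Z0 eps1_le eps20 hom.
set G := complete_triad X Y Z; set d := triad_dens R G.
have dE : d = dens R X Y Z by rewrite /d /triad_dens K3_complete /dens !cardsX.
have /andP[d0 d1] : 0 <= d <= 1 by apply: triad_dens01.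
have N0 : #|X|%:R * #|Y|%:R * #|Z|%:R != 0 :> R.
  by rewrite -!natrM pnatr_eq0 !muln_eq0 !cards_eq0 (negbTE X0) (negbTE Y0) (negbTE Z0).
have hE : \sum_(x in X) \sum_(y in Y) \sum_(z in Z) `|triad_h R G x y z|
    = 2 * d * (1 - d) * (#|X|%:R * #|Y|%:R * #|Z|%:R).
  (* [|h|] is [1 - d] on edges and [d] elsewhere. The three membership factors equal 1 here and only
     match the form of [card_Ebar_box]. *)
  transitivity (\sum_(x in X) \sum_(y in Y) \sum_(z in Z) (d + (1 - 2 * d) *
      (((x, y, z) \in Ebar H)%:R * ((x \in X)%:R * (y \in Y)%:R * (z \in Z)%:R)))).
    apply: eq_bigr => x xX; apply: eq_bigr => y yY; apply: eq_bigr => z zZ.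
    rewrite /triad_h K3_complete !in_setX xX yY zZ /= -/d.
    by case: ifP => _; [rewrite ger0_norm ?subr_ge0//|rewrite normrN ger0_norm//] => /=; ring.
  under eq_bigr do under eq_bigr do rewrite big_split /= sum_constE -mulr_sumr.
  under eq_bigr do rewrite big_split /= sum_constE -mulr_sumr.
  rewrite big_split /= sum_constE -mulr_sumr -card_Ebar_box//.
  have -> : #|Ebar H :&: setX (setX X Y) Z|%:R = d * (#|X|%:R * #|Y|%:R * #|Z|%:R).
    by rewrite dE /dens !natrM divfK.
  by ring.
exists 1, 1, 1; split; first by split; apply: ltr01.
split; first by split; apply: dev2_complete.
rewrite !expr1n !mulr1.
apply: le_trans (octahedron_le_norm X Y Z (triad_h_le1 G)) _.
rewrite hE [leLHS](_ : _ = 2 * d * (1 - d)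
  * #|X|%:R ^+ 2 * #|Y|%:R ^+ 2 * #|Z|%:R ^+ 2); last by ring.
do 3![apply: ler_wpM2r; first exact: sqr_ge0].
apply: le_trans eps1_le; move: hom; rewrite /homogeneous -dE.
by move=> /orP[/andP[]|/andP[]]; nra.
Qed.

End CompleteTriads.

(** * The decomposition with one complete bigraph per pair of parts *)

Section TrivialDecomposition.
Variables (V : finType) (P : {set {set V}}).
Hypothesis Ppart : partition P [set: V].

Let part (i : 'I_#|P|) : {set V} := enum_val i.

Lemma enum_val_partition_family : partition_family part [set: V].
Proof.
split; first exact: enum_val_inj.
suff -> : [set part i | i : 'I_#|P|] = P by [].
apply/setP => A; apply/imsetP/idP => [[i _ ->]|AP]; first exact: enum_valP.
by exists (enum_rank_in AP A); rewrite // /part enum_rankK_in.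
Qed.

Lemma const_partition_family (T : finType) (A : {set T}) :
  A != set0 -> partition_family (fun _ : 'I_1 => A) A.
Proof.
move=> A0; split; first by move=> i j _; rewrite !ord1.
have -> : [set A | _ : 'I_1] = [set A].
  by apply/setP => B; rewrite inE; apply/imsetP/eqP => [[i _ ->]//|->]; exists ord0.
by rewrite /partition /cover big_set1 eqxx trivIset1 inE eq_sym A0.
Qed.

Lemma trivial_decompositionP i j :
  partition_family (fun _ : 'I_1 => setX (part i) (part j)) (setX (part i) (part j)).
Proof.
apply: const_partition_family.
rewrite -card_gt0 cardsX muln_gt0 !card_gt0.
by rewrite !(partition_family_neq0 enum_val_partition_family).
Qed.

Definition trivial_decomposition : decomposition V #|P| 1 :=
  Decomposition enum_val_partition_family trivial_decompositionP.

End TrivialDecomposition.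

Section HomogeneousPartition.
Variables (R : realType) (H : graph3) (P : {set {set H}}) (eps eps1 eps2 : R).
Hypothesis Phom : homogeneous_partition eps P.
Hypotheses (eps_ge0 : 0 <= eps) (eps1_ge : 2 * eps <= eps1) (eps2_ge0 : 0 <= eps2).

Let D := trivial_decomposition Phom.1.

Let cover_part x : exists i, x \in vpart D i.
Proof. by apply/existsP; rewrite -(mem_partition_family (vpartP D)) inE. Qed.

Let part_neq0 i : vpart D i != set0.
Proof. exact: (partition_family_neq0 (vpartP D)). Qed.

Lemma trivial_decomposition_dev2 : dev2_decomposition eps1 eps2 D.
Proof.
rewrite /dev2_decomposition /npairs.
have -> : [set p : H * H | `[< exists i j a, (p.1, p.2) \in epart D i j a /\
    dev2_self eps2 (vpart D i) (vpart D j) (epart D i j a) >]] = setT.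
  apply/setP => -[x y]; rewrite !inE /=; apply/asboolP.
  have [i xi] := cover_part x; have [j yj] := cover_part y.
  exists i, j, ord0; split; first by rewrite /= in_setX; apply/andP.
  change (dev2_self eps2 (vpart D i) (vpart D j) (setX (vpart D i) (vpart D j))).
  rewrite /dev2_self bidens_complete//.
  exact: dev2_complete.
rewrite cardsT card_prod natrM -expr2 ler_piMl ?sqr_ge0//.
by move: eps_ge0 eps1_ge; lra.
Qed.

Lemma trivial_decomposition_dev23 : dev23_regular eps1 eps2 D.
Proof.
rewrite /dev23_regular; set W := fun x y z => _.
have [_ hom] := Phom; move: hom; set V := fun x y z => _ => hom.
(* Each triple outside all regular triads lies in a box that is not homogeneous. *)
have le : (ntriples W)%:R <= (ntriples (fun x y z => ~ V x y z))%:R :> R.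
  rewrite ler_nat; apply: subset_leq_card; apply/fintype.subsetP => -[[x y] z].
  rewrite !inE /= => /asboolP nreg; apply/asboolP => hxyz; apply: nreg.
  have [i xi] := cover_part x; have [j yj] := cover_part y.
  have [k zk] := cover_part z; exists i, j, k, ord0, ord0, ord0.
  split; first by rewrite inE /= !in_setX; apply/and3P; split; apply/andP.
  apply: (homogeneous_dev23 (eps := eps)) => //.
  have block m u : m \in vpart D u -> pblock P m = vpart D u.
    have [_ tP _] := and3P Phom.1.
    by move=> mu; apply: def_pblock => //; apply: enum_valP.
  by move: hxyz; rewrite /V (block _ _ xi) (block _ _ yj) (block _ _ zk).
have := ntriplesC R V; have : 0 <= #|H|%:R ^+ 3 :> R by exact: exprn_ge0.
by move: hom le eps1_ge eps_ge0; nra.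
Qed.

End HomogeneousPartition.

(** * Comparison of the growth functions *)

(** An infimum over a larger set is smaller; this includes the value [+oo] of an unsatisfiable
    [P]. *)
Lemma least_nat_le (R : realType) (P Q : nat -> Prop) :
  (forall m, P m -> Q m) -> (least_nat R Q <= least_nat R P)%E.
Proof. by move=> PQ; apply: ereal_inf_le_tmp => _ [m /PQ Qm <-]; exists m. Qed.

Section GrowthBounds.
Variables (R : realType) (C : graph3 -> Prop) (eps1 : R) (eps2 : nat -> R).

Lemma T_le_M_hom (eps : R) : 0 <= eps -> 2 * eps <= eps1 -> 0 <= eps2 1 ->
  (T_ C eps1 eps2 <= M_hom C eps)%E.
Proof.
move=> eps0 eps_le eps20; apply: least_nat_le => m [n0 hn0].
(* The threshold is at least 1 so that the vertex set, hence the partition, is nonempty and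
   [t >= 1]. *)
exists 1%N, (maxn n0 1); split=> // H CH; rewrite geq_max => /andP[Hn0 H0].
have [P Phom Pm] := hn0 H CH Hn0.
exists #|P|, 1%N; split => //.
  rewrite Pm andbT card_gt0; apply/set0Pn.
  have [x _] := card_gt0P H0.
  exists (pblock P x); apply: pblock_mem.
  by have [/and3P[/eqP -> _ _] _] := Phom; rewrite inE.
exists (trivial_decomposition Phom.1); split.
  exact: trivial_decomposition_dev2.
exact: (trivial_decomposition_dev23 Phom).
Qed.

Lemma M_weak_le_T (delta : R) : 0 < delta -> 20 * delta <= 1 ->
  eps1 = delta ^+ 40 ->
  (forall l, eps2 l <= (delta ^+ 2 / (2 * l.+1%:R)) ^+ 16) ->
  (M_weak C delta <= T_ C eps1 eps2)%E.
Proof.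
move=> d0 d1 eps1E eps2_le; apply: least_nat_le => m [L [n0 [L1 hn0]]].
exists n0 => H CH Hn0.
have [t [l [/andP[t1 tm] lL [D [_ reg]]]]] := hn0 H CH Hn0.
exists [set vpart D i | i : 'I_t]; last by rewrite (partition_family_card (vpartP D)).
have l0 : 0 < l.+1%:R :> R by rewrite ltr0n.
(* Chosen so that [2 * zeta * (l + 1) = delta ^+ 2]; the successor keeps the denominator nonzero for
   every [l]. *)
set zeta := delta ^+ 2 / (2 * l.+1%:R) in eps2_le *.
have zE : 2 * zeta * l.+1%:R = delta ^+ 2.
  by rewrite /zeta; field; rewrite gt_eqF.
have z0 : 0 <= zeta by rewrite divr_ge0 ?sqr_ge0 ?mulr_ge0// ltW.
have d21 : delta ^+ 2 <= 1 by rewrite expr2; nra.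
have lS : l%:R <= l.+1%:R :> R by rewrite ler_nat.
have l1 : 1 <= l.+1%:R :> R by rewrite ler1n.
have zl : zeta * l%:R <= zeta * l.+1%:R by apply: ler_wpM2l.
apply: (vertex_partition_weakly_regular (eps1 := eps1) (eps2 := eps2 l) (zeta := zeta)) => //.
- rewrite z0 /=; have := ler_wpM2l z0 l1; move: zE d21; lra.
- by move: zE d21 zl; lra.
(* Here [3 * zeta ^+ 4 * (l + 1) ^+ 4] is [3 / 16 * delta ^+ 8], which is below [delta ^+ 5]. *)
- have l3 : l%:R ^+ 3 <= l.+1%:R ^+ 4 :> R.
    apply: le_trans (_ : l.+1%:R ^+ 3 <= _).
      by rewrite ler_pXn2r ?nnegrE// ltW.
    by apply: ler_weXn2l.
  have z4 : 0 <= 3 * zeta ^+ 4 by rewrite mulr_ge0 ?exprn_ge0.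
  apply: le_trans (ler_wpM2l z4 l3) _.
  apply: le_trans (_ : delta ^+ 8 <= _); last first.
    by apply: ler_wiXn2l => //; [exact: ltW|move: d1 d0; lra].
  rewrite (exprM _ 2 4) -zE.
  have : 0 <= zeta ^+ 4 * l.+1%:R ^+ 4 by rewrite mulr_ge0 ?exprn_ge0// ltW.
  move: (l.+1%:R : R) => n M0.
  by rewrite [leRHS](_ : _ = 16 * (zeta ^+ 4 * n ^+ 4)); [lra|ring].
- by rewrite eps1E -exprM.
Qed.

End GrowthBounds.

Theorem theorem1p11 (R : realType) (k : nat) (hk : (1 <= k)%N) :
  exists K : nat, (1 <= K)%N /\
    forall C : graph3 -> Prop, hereditary C ->
      ~ Trip_class C (otimes k (U_graph k)) ->
      asymptotically (fun (eps1 : R) (eps2 : nat -> R) =>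
        (M_weak C (eps1 `^ (K%:R^-1)) <= T_ C eps1 eps2)%E /\
        (T_ C eps1 eps2 <= M_hom C (eps1 ^+ K))%E).
Proof.
(* [40 = 5 * 8]: the eighth root of [eps1] from the octahedron must be [delta ^+ 5]. The bound
   [20^-1 ^+ 40] on [eps1] ensures [20 * delta <= 1]. *)
exists 40; split=> // C _ _; exists (20^-1 ^+ 40); first by rewrite exprn_gt0.
move=> eps1 /andP[eps10 eps1_lt]; set delta := eps1 `^ _.
have delta0 : 0 < delta by exact: powR_gt0.
have eps1E : eps1 = delta ^+ 40.
  by rewrite -powR_mulrn ?ltW// -powRrM mulVf ?powRr1 ?ltW// pnatr_eq0.
have delta1 : 20 * delta <= 1.
  suff : delta < 20^-1 by lra.
  by rewrite -(@ltr_pXn2r _ 40) ?nnegrE ?(ltW delta0)// -eps1E.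
have zeta_gt0 l : 0 < delta ^+ 2 / (2 * l.+1%:R).
  by rewrite divr_gt0 ?exprn_gt0// mulr_gt0// ltr0n.
exists (fun l => (delta ^+ 2 / (2 * l.+1%:R)) ^+ 16) => [l|eps2 eps2_01 eps2_le].
  rewrite exprn_gt0//= exprn_ile1 ?(ltW (zeta_gt0 _))//.
  rewrite ler_pdivrMr ?mulr_gt0 ?ltr0n// mul1r.
  have : 1 <= l.+1%:R :> R by rewrite ler1n.
  have : delta ^+ 2 <= 1 by rewrite expr2; nra.
  by lra.
split; first exact: M_weak_le_T.
apply: T_le_M_hom; first exact/exprn_ge0/ltW.
  (* The upper bound needs only [2 * eps1 ^+ 40 <= eps1], which follows from
     [2 * eps1 ^+ 2 <= eps1]. *)
  have e1 : eps1 <= 20^-1.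
    by rewrite eps1E (le_trans (ler_wiXn2l _ _ (isT : (1 <= 40)%N))) ?expr1//; lra.
  apply: le_trans (_ : 2 * eps1 ^+ 2 <= _).
    by rewrite ler_wpM2l// ler_wiXn2l// ?ltW//; lra.
  by rewrite expr2; nra.
by case/andP: (eps2_01 1%N) => /ltW.
Qed.
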